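(* Let $n \ge 1$, let $L_1 = \{(0,\dotsc,0,s,0) : s \in [0,\infty)\} \subset \mathbb{R}^{2n}$ and let $M_1 = \mathbb{R}^{2n} \setminus L_1$. Then $(M_1, \omega_0|_{M_1})$ is symplectomorphic to $(\mathbb{R}^{2n}, \omega_0)$. Moreover, for any $\varepsilon > 0$ there is a symplectomorphism $\varphi \colon (M_1, \omega_0|_{M_1}) \to (\mathbb{R}^{2n}, \omega_0)$ which is the identity outside of $\mathbb{B}_0^{2n-2}(\varepsilon) \times W(\varepsilon)$ (that is, $\varphi(p) = p$ for every $p \in M_1$ with $p \notin \mathbb{B}_0^{2n-2}(\varepsilon) \times W(\varepsilon)$), where $$W(\varepsilon) = \mathbb{B}_0^2(\varepsilon) \cup \left\{(x,y) \in \mathbb{R}^2 : x > \tfrac{\sqrt{2}\,\varepsilon}{2},\ x|y| < \tfrac{\varepsilon^2}{2}\right\}.$$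
   Context: Coordinates on $\mathbb{R}^{2n}$ are $(x_1,y_1,\dotsc,x_n,y_n)$ and $\omega_0 = dx_1\wedge dy_1 + \dotsb + dx_n \wedge dy_n$ is the standard symplectic form. $\mathbb{B}_x^d(r)$ denotes the open ball in $\mathbb{R}^d$ centered at $x$ with radius $r$ (for $d=0$ it is the single point $\mathbb{R}^0$). In the product $\mathbb{B}_0^{2n-2}(\varepsilon) \times W(\varepsilon) \subset \mathbb{R}^{2n-2}\times\mathbb{R}^2 = \mathbb{R}^{2n}$, the first factor is in the coordinates $(x_1,y_1,\dotsc,x_{n-1},y_{n-1})$ and the second factor is in the coordinates $(x_n,y_n)$. Points of $L_1$ have $x_n = s\ge 0$ and all other coordinates equal to $0$. A symplectomorphism is a diffeomorphism pulling back the target symplectic form to the source symplectic form. *)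

(* Defs.v *)
From mathcomp Require Import all_boot all_order all_algebra.
From mathcomp Require Import all_classical all_reals all_analysis.

Set Implicit Arguments.
Unset Strict Implicit.
Unset Printing Implicit Defensive.

Import Order.TTheory GRing.Theory Num.Theory.
Import numFieldNormedType.Exports.
Local Open Scope classical_set_scope.
Local Open Scope ring_scope.

(* The library norm on 'rV[R]_d is the sup norm (which induces the usual
   topology and the usual differentials), so Euclidean balls are defined here. *)
Definition enorm (R : realType) (d : nat) (v : 'rV[R]_d) : R :=
  Num.sqrt (\sum_(j < d) v 0 j ^+ 2).

Definition eball (R : realType) (d : nat) (c : 'rV[R]_d) (r : R) :
  set 'rV[R]_d := [set v | enorm (v - c) < r].

(* Maps defined on a set U are represented by total functions whose values
   outside of U are irrelevant.  The notions below are meant for open U: they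
   then depend only on the restriction of f to U, and since the space is
   finite-dimensional, continuity of all the directional derivatives amounts
   to continuity of the differential. *)
Fixpoint Ck_on (R : realType) (d e : nat) (k : nat) (U : set 'rV[R]_d)
    (f : 'rV[R]_d -> 'rV[R]_e) : Prop :=
  match k with
  | 0%N => forall p, U p -> {for p, continuous f}
  | k'.+1 => (forall p, U p -> differentiable f p) /\
             (forall v : 'rV[R]_d, Ck_on k' U (fun p => 'D_v f p))
  end.

Definition smooth_on (R : realType) (d e : nat) (U : set 'rV[R]_d)
    (f : 'rV[R]_d -> 'rV[R]_e) : Prop :=
  forall k : nat, Ck_on k U f.

Definition diffeomorphism (R : realType) (d : nat) (U V : set 'rV[R]_d)
    (f : 'rV[R]_d -> 'rV[R]_d) : Prop :=
  exists g : 'rV[R]_d -> 'rV[R]_d,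
    [/\ forall p, U p -> V (f p) /\ g (f p) = p,
        forall q, V q -> U (g q) /\ f (g q) = q,
        smooth_on U f &
        smooth_on V g].

(* A differential 2-form: [w p u v] is its value at the point p on the tangent
   vectors u and v. *)
Definition form2 (R : realType) (d : nat) : Type :=
  'rV[R]_d -> 'rV[R]_d -> 'rV[R]_d -> R.

Definition pullback (R : realType) (d e : nat) (f : 'rV[R]_d -> 'rV[R]_e)
    (w : form2 R e) : form2 R d :=
  fun p u v => w (f p) ('d f p u) ('d f p v).

Definition symplectomorphism (R : realType) (d : nat)
    (U : set 'rV[R]_d) (wU : form2 R d) (V : set 'rV[R]_d) (wV : form2 R d)
    (f : 'rV[R]_d -> 'rV[R]_d) : Prop :=
  diffeomorphism U V f /\
  (forall p, U p -> forall u v, pullback f wV p u v = wU p u v).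

Definition symplectomorphic (R : realType) (d : nat)
    (U : set 'rV[R]_d) (wU : form2 R d) (V : set 'rV[R]_d) (wV : form2 R d) :
    Prop :=
  exists f : 'rV[R]_d -> 'rV[R]_d, symplectomorphism U wU V wV f.

(* R^(2n) is 'rV[R]_(2 * n) with coordinates (x_1, y_1, ..., x_n, y_n); for
   i : 'I_n, the coordinates x_(i+1) and y_(i+1) have index 2i and 2i + 1. *)
Lemma xidx_subproof (n : nat) (i : 'I_n) : (2 * i < 2 * n)%N.
Proof. by rewrite ltn_pmul2l. Qed.

Lemma yidx_subproof (n : nat) (i : 'I_n) : ((2 * i).+1 < 2 * n)%N.
Proof.
apply: (@leq_trans (2 * i.+1)); first by rewrite mulnS add2n.
by rewrite leq_pmul2l.
Qed.

Definition xidx (n : nat) (i : 'I_n) : 'I_(2 * n) := Ordinal (xidx_subproof i).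
Definition yidx (n : nat) (i : 'I_n) : 'I_(2 * n) := Ordinal (yidx_subproof i).

Definition dx (R : realType) (n : nat) (i : 'I_n) (u : 'rV[R]_(2 * n)) : R :=
  u 0 (xidx i).
Definition dy (R : realType) (n : nat) (i : 'I_n) (u : 'rV[R]_(2 * n)) : R :=
  u 0 (yidx i).

Definition wedge (R : realType) (d : nat) (a b : 'rV[R]_d -> R)
    (u v : 'rV[R]_d) : R :=
  a u * b v - a v * b u.

Definition omega0 (R : realType) (n : nat) : form2 R (2 * n) :=
  fun _ u v => \sum_(i < n) wedge (dx i) (dy i) u v.
Arguments omega0 R n : clear implicits.

(* From here on the half-dimension is n.+1, so that the last pair of
   coordinates has index ord_max : 'I_n.+1. *)
Definition L1 (R : realType) (n : nat) : set 'rV[R]_(2 * n.+1) :=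
  [set p | exists2 s : R, 0 <= s &
     p = \row_j (if j == xidx (ord_max : 'I_n.+1) then s else 0)].
Arguments L1 R n : clear implicits.

Definition M1 (R : realType) (n : nat) : set 'rV[R]_(2 * n.+1) := ~` L1 R n.
Arguments M1 R n : clear implicits.

Definition W (R : realType) (eps : R) : set 'rV[R]_2 :=
  eball 0 eps `|`
  [set q | q 0 0 > Num.sqrt 2 * eps / 2 /\ q 0 0 * `|q 0 1| < eps ^+ 2 / 2].

Definition split_last (R : realType) (n : nat) (p : 'rV[R]_(2 * n.+1)) :
    'rV[R]_(2 * n) * 'rV[R]_2 :=
  let p' : 'rV[R]_(2 * n + 2) := castmx (erefl 1%N, mulnSr 2 n) p in
  (lsubmx p', rsubmx p').

(* The product A x B, viewed as a subset of R^(2n+2) = R^(2n) x R^2. *)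
Definition prod_last (R : realType) (n : nat) (A : set 'rV[R]_(2 * n))
    (B : set 'rV[R]_2) : set 'rV[R]_(2 * n.+1) :=
  [set p | A (split_last p).1 /\ B (split_last p).2].

(* Main.v *)
Require Import Defs.
From mathcomp Require Import all_boot all_order all_algebra.
From mathcomp Require Import all_classical all_reals all_analysis.
From mathcomp Require Import zify ring lra.

(* Idea.  Write p = (z, x, y) with (x, y) the last pair of coordinates, let
   q = |z|^2 and look for phi with a mixed generating function
   x Y + s(x, Y, q), where s = k Y G(lev) and lev = M (1 + x^6) gap,
   gap = sqrt (x^6 + Y^2 + q) - x^3.  The function lev is smooth and positive
   off the ray, vanishes exactly on it, and {lev < 1} lies in the prescribed
   neighbourhood once M is large.  With G = 0 on [1, +oo) and G ~ - ln near 0,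
   the map
     (z, x, Y + s_x) |-> (e^{i t} z, x + s_Y, Y),   t = - 2 s_q,
   is the identity where lev >= 1; it is symplectic because
   d(s_x dx + s_Y dY + s_q dq) = 0.  For k small both Y |-> Y + s_x and
   x |-> x + s_Y are increasing along coordinate lines.  The first is onto the
   fibres of M_1 (near the ray s_x -> 0), while the second is onto R, because
   s_Y -> +oo at the tip of the ray.  Hence phi is a diffeomorphism from M_1
   onto R^(2n); no flow of a vector field is needed. *)

Set Implicit Arguments.
Unset Strict Implicit.
Unset Printing Implicit Defensive.

Import Order.TTheory GRing.Theory Num.Theory.
Import numFieldNormedType.Exports.
Local Open Scope classical_set_scope.
Local Open Scope ring_scope.

(** * Differential calculus and smooth functions on row spaces *)

Section DirectionalDerivatives.
Context {R : realType} {d : nat}.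
Implicit Types (f g : 'rV[R]_d -> R) (p v : 'rV[R]_d) (df dg : 'rV[R]_d -> R).

(** The cube in [gap] is dictated by the fibre [x = 0], [q = 0], which meets the ray at its tip.
    There [s_x] must tend to 0 with [Y]; with [sqrt (x^2 + Y^2 + q) - x] instead, [s_x] would tend
    to [k] or [- k] according to the sign of [Y], and [Y |-> Y + s_x] would skip an interval around
    0. With the cube, the term [3 x^2 / rho] of the logarithmic derivative of [lev] vanishes at
    [x = 0]. The power is odd so that [gap] vanishes for [x >= 0] only. The weight [1 + x^6]
    dominates [x^5]: for large [x], [gap] is about [(Y^2 + q) / (2 x^3)], so [lev < 1] bounds
    [x^2 Y^2], as the hyperbolic part of [W] demands. The logarithm reconciles two opposite needs:
    [s_Y] has to be unbounded at the tip, yet monotonicity in [x] and in [Y] has to survive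
    everywhere for a single [k]. Since [G] is logarithmic, [K D = - D G'(D)] and its derivative
    remain bounded down to [D = 0]; the terms of the mixed derivative [s_xY] are then either bounded
    or nonnegative. *)

Definition has_derivs f p df :=
  differentiable f p /\ forall v, 'D_v f p = df v.

Lemma has_derivs_eq f p df dg :
  has_derivs f p df -> (forall v, df v = dg v) -> has_derivs f p dg.
Proof. by case=> h1 h2 e; split => // v; rewrite h2. Qed.

Lemma has_derivs_cst (c : R) p : has_derivs (fun=> c) p (fun=> 0).
Proof.
split; first exact: differentiable_cst.
by move=> v; exact: derive_cst.
Qed.

Lemma has_derivs_coord (i : 'I_d) p :
  has_derivs (fun q : 'rV[R]_d => q 0 i) p (fun v => v 0 i).
Proof.
split; first exact: differentiable_coord.
move=> v.
have := derive_mx (@derivable_id _ _ p v).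
by rewrite derive_id => /matrixP/(_ 0 i); rewrite mxE => ->.
Qed.

Lemma has_derivsD f g p df dg : has_derivs f p df -> has_derivs g p dg ->
  has_derivs (fun q => f q + g q) p (fun v => df v + dg v).
Proof.
case=> f1 f2 [g1 g2]; split; first exact: differentiableD.
by move=> v; rewrite deriveD ?f2 ?g2 //; exact: diff_derivable.
Qed.

Lemma has_derivsN f p df : has_derivs f p df ->
  has_derivs (fun q => - f q) p (fun v => - df v).
Proof.
case=> f1 f2; split; first exact: differentiableN.
by move=> v; rewrite deriveN ?f2 //; exact: diff_derivable.
Qed.

Lemma has_derivsB f g p df dg : has_derivs f p df -> has_derivs g p dg ->
  has_derivs (fun q => f q - g q) p (fun v => df v - dg v).
Proof. by move=> hf hg; apply: has_derivsD => //; exact: has_derivsN. Qed.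

Lemma has_derivsM f g p df dg : has_derivs f p df -> has_derivs g p dg ->
  has_derivs (fun q => f q * g q) p (fun v => f p * dg v + g p * df v).
Proof.
case=> f1 f2 [g1 g2]; split; first exact: differentiableM.
by move=> v; rewrite deriveM ?f2 ?g2 //; exact: diff_derivable.
Qed.

Lemma has_derivs_comp (h : R -> R) (h' : R) f p df : has_derivs f p df ->
  is_derive (f p) 1 h h' -> has_derivs (fun q => h (f q)) p (fun v => h' * df v).
Proof.
case=> f1 f2 [h1 h2].
have dh : differentiable h (f p) by apply/derivable1_diffP.
have dhf : differentiable (h \o f) p by exact: differentiable_comp.
split => // v.
rewrite (deriveE _ dhf) diff_comp //= -(deriveE _ f1) f2.
by rewrite diff1E // derive1E h2; exact: mulrC.
Qed.

Lemma has_derivsV f p df : has_derivs f p df -> f p != 0 ->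
  has_derivs (fun q => (f q)^-1) p (fun v => - ((f p)^-1 * (f p)^-1) * df v).
Proof.
move=> hf f0; have [f1 f2] := hf.
split; first exact: differentiableV.
move=> v; rewrite deriveV //; last exact: diff_derivable.
by rewrite f2 -[_ *: _]/(_ * _) expr2 invfM.
Qed.

Lemma has_derivs_sum (I : Type) (s : seq I) (P : pred I)
    (F : I -> 'rV[R]_d -> R) p (dF : I -> 'rV[R]_d -> R) :
  (forall i, P i -> has_derivs (F i) p (dF i)) ->
  has_derivs (fun q => \sum_(i <- s | P i) F i q) p
    (fun v => \sum_(i <- s | P i) dF i v).
Proof.
move=> h; elim: s => [|i s IH].
  under [X in has_derivs X]eq_fun do rewrite big_nil.
  by apply: (has_derivs_eq (has_derivs_cst 0 p)) => v; rewrite big_nil.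
under [X in has_derivs X]eq_fun do rewrite big_cons.
case Pi : (P i).
  apply: (has_derivs_eq (has_derivsD (h i Pi) IH)) => v.
  by rewrite big_cons Pi.
by apply: (has_derivs_eq IH) => v; rewrite big_cons Pi.
Qed.

(** Reduces statements along a segment to one-variable calculus: the two difference quotients are
    the same function. *)
Lemma is_derive_line f p v (t : R) : differentiable f (p + t *: v) ->
  is_derive t 1 (fun s => f (p + s *: v)) ('D_v f (p + t *: v)).
Proof.
move=> df.
have e : (fun h => h^-1 *: (((fun s => f (p + s *: v)) \o shift t) (h *: 1) - f (p + t *: v)))
    = (fun h => h^-1 *: ((f \o shift (p + t *: v)) (h *: v) - f (p + t *: v))).
  apply/funext => h /=; congr (_ *: (f _ - _)).
  by rewrite [h *: 1]mulr1 scalerDl addrCA.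
have := @diff_derivable _ _ _ f _ v df.
by split; rewrite /derivable /derive e.
Qed.

End DirectionalDerivatives.

(** * Row-valued maps and the epsilon form of differentiability *)

Lemma continuous_row_mx (R : realType) (d e : nat) (F : 'rV[R]_d -> 'rV[R]_e) p :
  (forall j, {for p, continuous (fun q => F q 0 j)}) -> {for p, continuous F}.
Proof.
move=> h; rewrite /prop_for /continuous_at.
apply/(cvgrPdist_le (FF := nbhs_filter p)) => /= e0 e0_gt0.
have : \forall x \near p, forall j, `|F p 0 j - F x 0 j| <= e0.
  apply: (filter_forall (nbhs_filter p)) => j.
  exact: (cvgrPdist_le (FF := nbhs_filter p) _ _).1 (h j) _ e0_gt0.
apply: filterS => x hx.
rewrite /Num.Def.normr /= mx_normrE (bigmax_le _ (ltW e0_gt0)) //= => -[i j] _.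
by rewrite !mxE /= (ord1 i).
Qed.

Lemma diff_row_mx (R : realType) (d e : nat) (F : 'rV[R]_d -> 'rV[R]_e) p :
  (forall j, differentiable (fun q => F q 0 j) p) -> differentiable F p.
Proof.
move=> h.
have -> : F = \sum_(j < e) (fun q => F q 0 j *: delta_mx (0 : 'I_1) j).
  apply/funext => q; rewrite [LHS]row_sum_delta fct_sumE.
  by apply: eq_bigr => j _.
by apply: differentiable_sum => j; exact: differentiableZl.
Qed.

Lemma derive_row_mx (R : realType) (d e : nat) (F : 'rV[R]_d -> 'rV[R]_e) p v j :
  differentiable F p -> ('D_v F p) 0 j = 'D_v (fun q => F q 0 j) p.
Proof. by move=> h; rewrite derive_mx ?mxE //; exact: diff_derivable. Qed.

Lemma differentiable_approx (R : realType) (V W : normedModType R)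
    (f : V -> W) (p : V) : differentiable f p ->
  forall e, 0 < e -> \forall h \near 0, `|f (h + p) - f p - 'd f p h| <= e * `|h|.
Proof.
move=> /diff_locally; set L := 'd f p => h e e0.
move: h => /eqaddoP /(_ e e0).
by apply: filterS => x; rewrite /= fctE opprD addrA.
Qed.

(** Tests differentiability against a candidate differential, which suits maps known only
    implicitly, such as the fibrewise inverses below. *)
Lemma approx_differentiable (R : realType) (V W : normedModType R)
    (f : V -> W) (p : V) (L : {linear V -> W}) : continuous L ->
  (forall e, 0 < e -> \forall h \near 0, `|f (h + p) - f p - L h| <= e * `|h|) ->
  differentiable f p /\ 'd f p = L :> (V -> W).
Proof.
move=> cL h.
have dxf' : (fun h => f (h + p)) = cst (f p) + L +o_ 0 id.
  apply/eqaddoP => e e0; apply: filterS (h e e0) => x.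
  by rewrite /= fctE opprD addrA.
have dxf : forall h, f (h + p) = f p + L h +o_(h \near 0) h.
  by apply: eqaddoEx => x; rewrite -[LHS]/((fun h => f (h + p)) x) dxf'.
split; last exact: (diff_unique cL dxf').
apply/diffP => /=.
(* The differential is defined by choice, so it is enough to exhibit [L] as one witness of its
   specification. *)
apply: (@getPex _ (fun (df : {linear V -> W}) => continuous df /\
  forall y, f y = f (lim (nbhs p)) + df (y - lim (nbhs p))
                  +o_(y \near p) (y - lim (nbhs p)))).
exists L; split => //; apply: eqaddoEx => y.
rewrite lim_id // -[in LHS](subrK p y).
rewrite dxf; congr (_ + _).
rewrite -(comp_centerK p id) -[X in the_littleo _ _ _ X](comp_centerK p).
by rewrite -[_ (y - p)]/((_ \o (center p)) y) -littleo_center0.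
Qed.

Lemma near_eq_differentiable (R : realType) (V W : normedModType R)
    (f g : V -> W) (a : V) :
  (\near a, f a = g a) -> differentiable f a -> differentiable g a.
Proof.
move=> fg df.
suff [] : differentiable g a /\ 'd g a = 'd f a :> (V -> W) by [].
apply: approx_differentiable; first exact: diff_continuous.
move=> e e0; have h := differentiable_approx df e0.
rewrite -(nbhs_singleton fg).
have : \forall h \near 0, f (h + a) = g (h + a).
  by move/nbhs0P: fg; apply: filterS => x; rewrite addrC.
move=> fg'; near=> x; rewrite -(near fg' x) //; exact: (near h).
Unshelve. all: by end_near. Qed.

(** * Scalar functions of class C^k and their closure properties *)

Section SmoothFunctions.
Context {R : realType}.

(** Scalar counterpart of [Ck_on], for which products, quotients and compositions with one-variable
    functions make sense; [smooth_on_coord] leads back to row-valued maps. *)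
Fixpoint Cks (d : nat) (k : nat) (U : set 'rV[R]_d) (f : 'rV[R]_d -> R) : Prop :=
  match k with
  | 0%N => forall p, U p -> {for p, continuous f}
  | k'.+1 => (forall p, U p -> differentiable f p) /\
             (forall v : 'rV[R]_d, Cks k' U (fun p => 'D_v f p))
  end.

Lemma Cks_ext d k (U : set 'rV[R]_d) f g : open U ->
  (forall p, U p -> f p = g p) -> Cks k U f -> Cks k U g.
Proof.
move=> oU; elim: k f g => [|k IH] f g fg /=.
  move=> h p Up.
  have e : {near p, f =1 g} by apply: filterS fg _; exact: open_nbhs_nbhs.
  rewrite /prop_for /continuous_at -(fg p Up).
  exact: cvg_trans (near_eq_cvg e) (h p Up).
have e p : U p -> \near p, f p = g p.
  by move=> Up; apply: filterS fg _; exact: open_nbhs_nbhs.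
move=> [h1 h2]; split.
  by move=> p Up; exact: near_eq_differentiable (e _ Up) (h1 _ Up).
move=> v; apply: IH (h2 v) => p Up.
exact/near_eq_derive/e.
Qed.


Lemma CksW d k (U : set 'rV[R]_d) f : Cks k.+1 U f -> Cks k U f.
Proof.
elim: k f => [|k IH] f.
  by case=> h _ p Up; exact: differentiable_continuous (h p Up).
by case=> h1 h2; split => // v; apply: IH; exact: h2.
Qed.

Lemma CksS d k (U : set 'rV[R]_d) f (df : 'rV[R]_d -> 'rV[R]_d -> R) : open U ->
  (forall p, U p -> has_derivs f p (df p)) ->
  (forall v, Cks k U (fun p => df p v)) -> Cks k.+1 U f.
Proof.
move=> oU h hd; split; first by move=> p /h [].
move=> v; apply: Cks_ext (hd v) => // p Up.
by have [_ ->] := h p Up.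
Qed.

Lemma Cks_derivs d k (U : set 'rV[R]_d) f p : Cks k.+1 U f -> U p ->
  has_derivs f p (fun v => 'D_v f p).
Proof. by case=> h _ /h. Qed.

Lemma Cks_deriv d k (U : set 'rV[R]_d) f v : Cks k.+1 U f ->
  Cks k U (fun p => 'D_v f p).
Proof. by case=> _; exact. Qed.

Lemma Cks_cst d k (U : set 'rV[R]_d) (c : R) : open U -> Cks k U (fun=> c).
Proof.
move=> oU; elim: k c => [|k IH] c; first by move=> p _; exact: cst_continuous.
apply: (CksS (df := fun _ _ => 0) oU) => [p _|v]; last exact: IH.
exact: has_derivs_cst.
Qed.

Lemma Cks_coord d k (U : set 'rV[R]_d) i : open U -> Cks k U (fun p => p 0 i).
Proof.
move=> oU; case: k => [|k]; first by move=> p _; exact: coord_continuous.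
apply: (CksS (df := fun _ v => v 0 i) oU) => [p _|v].
  exact: has_derivs_coord.
exact: Cks_cst.
Qed.

Lemma CksD d k (U : set 'rV[R]_d) f g : open U ->
  Cks k U f -> Cks k U g -> Cks k U (fun p => f p + g p).
Proof.
move=> oU; elim: k f g => [|k IH] f g hf hg.
  by move=> p Up; apply: continuousD; [exact: hf | exact: hg].
apply: (CksS oU) => [p Up|v].
  by apply: has_derivsD; [exact: Cks_derivs hf Up | exact: Cks_derivs hg Up].
by apply: IH; exact: Cks_deriv.
Qed.

Lemma CksM d k (U : set 'rV[R]_d) f g : open U ->
  Cks k U f -> Cks k U g -> Cks k U (fun p => f p * g p).
Proof.
move=> oU; elim: k f g => [|k IH] f g hf hg.
  by move=> p Up; apply: continuousM; [exact: hf | exact: hg].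
apply: (CksS oU) => [p Up|v].
  by apply: has_derivsM; [exact: Cks_derivs hf Up | exact: Cks_derivs hg Up].
by apply: CksD => //; apply: IH; try exact: CksW; exact: Cks_deriv.
Qed.

Lemma CksN d k (U : set 'rV[R]_d) f : open U -> Cks k U f -> Cks k U (fun p => - f p).
Proof.
move=> oU hf; apply: (@Cks_ext _ _ _ (fun p => -1 * f p)) => //.
  by move=> p _; rewrite mulN1r.
by apply: CksM => //; exact: Cks_cst.
Qed.

Lemma CksB d k (U : set 'rV[R]_d) f g : open U ->
  Cks k U f -> Cks k U g -> Cks k U (fun p => f p - g p).
Proof. by move=> oU hf hg; apply: CksD => //; exact: CksN. Qed.

Lemma CksX d k (U : set 'rV[R]_d) f n : open U -> Cks k U f -> Cks k U (fun p => f p ^+ n).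
Proof.
move=> oU hf; elim: n => [|n IH].
  by under [X in Cks _ _ X]eq_fun do rewrite expr0; exact: Cks_cst.
by under [X in Cks _ _ X]eq_fun do rewrite exprS; exact: CksM.
Qed.

Lemma Cks_sum d k (U : set 'rV[R]_d) (I : Type) (s : seq I) (P : pred I)
    (F : I -> 'rV[R]_d -> R) : open U -> (forall i, P i -> Cks k U (F i)) ->
  Cks k U (fun p => \sum_(i <- s | P i) F i p).
Proof.
move=> oU h; elim: s => [|i s IH].
  by under [X in Cks _ _ X]eq_fun do rewrite big_nil; exact: Cks_cst.
under [X in Cks _ _ X]eq_fun do rewrite big_cons.
by case Pi : (P i) => //; apply: CksD => //; exact: h.
Qed.

(* For families of one-variable functions closed under differentiation up to
   smooth operations: {1/x}, {cos, sin}, {flatp p | p polynomial}. *)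
Lemma Cks_fam d (I : Type) (h : I -> R -> R) (dom : set R)
    (h' : I -> R -> R) (U : set 'rV[R]_d) f : open U ->
  (forall p, U p -> dom (f p)) ->
  (forall i x, dom x -> is_derive x 1 (h i) (h' i x)) ->
  (forall k, (forall i, Cks k U (h i \o f)) -> Cks k U f ->
     forall i, Cks k U (h' i \o f)) ->
  forall k, Cks k U f -> forall i, Cks k U (h i \o f).
Proof.
move=> oU Uf hd hc; elim=> [|k IH] hf i.
  move=> p Up; apply: continuous_comp; first exact: hf.
  apply: differentiable_continuous; apply/derivable1_diffP.
  by have [] := hd i _ (Uf _ Up).
have hf' := CksW hf.
apply: (CksS (df := fun p v => h' i (f p) * 'D_v f p) oU) => [p Up|v].
  by apply: has_derivs_comp; [exact: Cks_derivs hf Up | exact/hd/Uf].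
by apply: CksM; [by []|exact: hc (IH hf') hf' i | exact: Cks_deriv].
Qed.

Lemma CksV d k (U : set 'rV[R]_d) f : open U -> (forall p, U p -> f p != 0) ->
  Cks k U f -> Cks k U (fun p => (f p)^-1).
Proof.
move=> oU f0 hf.
apply: (@Cks_fam _ unit (fun=> GRing.inv) [set x | x != 0]
  (fun _ x => - (x^-1 * x^-1)) _ _ oU _ _ _ k hf tt) => //=.
  move=> _ x x0; apply: is_derive_eq; first exact: is_deriveV.
  by rewrite [_ *: _]mulr1 -[x ^- 2]/((x ^+ 2)^-1) expr2 invfM.
by move=> l h _ i; apply: CksN => //; apply: CksM => //; exact: h.
Qed.

Lemma Cks_div d k (U : set 'rV[R]_d) f g : open U -> (forall p, U p -> g p != 0) ->
  Cks k U f -> Cks k U g -> Cks k U (fun p => f p / g p).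
Proof. by move=> oU g0 hf hg; apply: CksM => //; exact: CksV. Qed.

Lemma Cks_sqrt d k (U : set 'rV[R]_d) f : open U -> (forall p, U p -> 0 < f p) ->
  Cks k U f -> Cks k U (fun p => Num.sqrt (f p)).
Proof.
move=> oU f0 hf.
apply: (@Cks_fam _ unit (fun=> Num.sqrt) [set x | 0 < x]
  (fun _ x => (2 * Num.sqrt x)^-1) _ _ oU _ _ _ k hf tt) => //=.
move=> l h _ i; apply: CksV => //.
  by move=> p Up; rewrite mulf_neq0 // sqrtr_eq0 -ltNge f0.
by apply: CksM => //; [exact: Cks_cst | exact: h].
Qed.

Lemma Cks_ln d k (U : set 'rV[R]_d) f : open U -> (forall p, U p -> 0 < f p) ->
  Cks k U f -> Cks k U (fun p => ln (f p)).
Proof.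
move=> oU f0 hf.
apply: (@Cks_fam _ unit (fun=> @ln R) [set x | 0 < x]
  (fun _ x => x^-1) _ _ oU _ _ _ k hf tt) => //=.
by move=> l h hk i; apply: CksV => // p Up; rewrite gt_eqF // f0.
Qed.

Lemma Cks_trigo d k (U : set 'rV[R]_d) f : open U -> Cks k U f ->
  Cks k U (fun p => cos (f p)) /\ Cks k U (fun p => sin (f p)).
Proof.
move=> oU hf.
have h b : Cks k U ((if b then @cos R else @sin R) \o f).
  apply: (@Cks_fam _ bool (fun b => if b then @cos R else @sin R) setT
    (fun b x => if b then - sin x else cos x) _ _ oU _ _ _ k hf) => //=.
    by move=> [] x _; [exact: is_derive_cos | exact: is_derive_sin].
  by move=> {hf b}k h hk []; [apply: CksN => //; exact: (h false) | exact: (h true)].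
by split; [exact: (h true) | exact: (h false)].
Qed.

Lemma row_sum_derive d (g : 'rV[R]_d -> R) p v : differentiable g p ->
  'D_v g p = \sum_(j < d) v 0 j * 'D_(delta_mx 0 j) g p.
Proof.
move=> dg; rewrite deriveE // [in LHS](row_sum_delta v) linear_sum.
by apply: eq_bigr => j _; rewrite linearZ deriveE.
Qed.

(** Induction on [k] with [F] fixed: by the chain rule a directional derivative of [g \o F] is a sum
    of derivatives of coordinates of [F] times partial derivatives of [g] composed with [F], and the
    induction hypothesis applies to the latter. *)
Lemma Cks_comp d e k (U : set 'rV[R]_d) (V : set 'rV[R]_e)
    (F : 'rV[R]_d -> 'rV[R]_e) (g : 'rV[R]_e -> R) : open U ->
  (forall p, U p -> V (F p)) -> (forall j, Cks k U (fun p => F p 0 j)) ->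
  Cks k V g -> Cks k U (fun p => g (F p)).
Proof.
move=> oU UV; elim: k g => [|k IH] g hF hg.
  move=> p Up; apply: continuous_comp; last exact/hg/UV.
  by apply: continuous_row_mx => j; exact: hF.
have dF p : U p -> differentiable F p.
  by move=> Up; apply: diff_row_mx => j; case: (hF j) => h _; exact: h.
have [dg hg'] := hg.
apply: (CksS (df := fun p v => \sum_(j < e)
    'D_v (fun q => F q 0 j) p * 'D_(delta_mx 0 j) g (F p)) oU) => [p Up|v].
  have dgF : differentiable (g \o F) p.
    by apply: differentiable_comp; [exact: dF | exact/dg/UV].
  have dFp := dF p Up; have dgp := dg _ (UV _ Up).
  split => // v.
  rewrite (deriveE _ dgF) (diff_comp dFp dgp) /= -(deriveE _ dgp).
  rewrite row_sum_derive //=.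
  by apply: eq_bigr => j _; rewrite -(deriveE _ dFp) derive_row_mx.
move=> /=; apply: Cks_sum => // j _; apply: CksM => //; first exact: Cks_deriv.
by apply: (IH (fun q => 'D_(delta_mx 0 j) g q)) => [i|]; [exact: CksW | exact: hg'].
Qed.

Definition smooth d (U : set 'rV[R]_d) f := forall k, Cks k U f.

Lemma smooth_on_coord d e (U : set 'rV[R]_d) (F : 'rV[R]_d -> 'rV[R]_e) : open U ->
  (forall j, smooth U (fun p => F p 0 j)) -> smooth_on U F.
Proof.
move=> oU hF k; elim: k F hF => [|k IH] F hF.
  move=> p Up; apply: differentiable_continuous.
  by apply: diff_row_mx => j; case: (hF j 1%N) => h _; exact: h.
have dF p : U p -> differentiable F p.
  by move=> Up; apply: diff_row_mx => j; case: (hF j 1%N) => h _; exact: h.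
split => // v; apply: IH => j m.
apply: (@Cks_ext _ _ _ (fun p => 'D_v (fun q => F q 0 j) p)) => //.
  by move=> p Up; rewrite derive_row_mx //; exact: dF.
exact: Cks_deriv (hF j m.+1).
Qed.

End SmoothFunctions.

(** * Inverses of maps that change one coordinate *)

Section FiberwiseInverse.
Context {R : realType} {d : nat}.
Implicit Types (p q v w : 'rV[R]_d) (F h : 'rV[R]_d -> R) (i j : 'I_d).

Definition upd p j (a : R) : 'rV[R]_d := \row_i (if i == j then a else p 0 i).

Lemma updj p j a : upd p j a 0 j = a.
Proof. by rewrite mxE eqxx. Qed.

Lemma upd_id p j : upd p j (p 0 j) = p.
Proof. by apply/rowP => i; rewrite mxE; case: eqP => [->|]. Qed.

Lemma upd_upd p j a b : upd (upd p j a) j b = upd p j b.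
Proof. by apply/rowP => i; rewrite !mxE; case: eqP. Qed.

(** Exhibits a coordinate fibre as an affine line, so that [line_increasing] and [line_IVT] apply to
    it. *)
Lemma upd_line p j a : upd p j a = upd p j 0 + a *: delta_mx 0 j.
Proof.
apply/rowP => i; rewrite !mxE /=; case: eqP => _ /=.
  by rewrite mulr1 add0r.
by rewrite mulr0 addr0.
Qed.

Lemma coord_le_norm v i : `|v 0 i| <= `|v|.
Proof.
rewrite [leRHS]/Num.Def.normr /= mx_normrE.
exact: (le_bigmax _ (fun ij => `|v ij.1 ij.2|) (0, i)).
Qed.

Lemma norm_le_coord v (e : R) : 0 <= e -> (forall i, `|v 0 i| <= e) -> `|v| <= e.
Proof.
move=> e0 h; rewrite /Num.Def.normr /= mx_normrE bigmax_le //= => -[i k] _ /=.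
by rewrite (ord1 i).
Qed.

Lemma line_increasing F p v (a b : R) : a < b ->
  (forall s, a <= s <= b -> differentiable F (p + s *: v)) ->
  (forall s, a <= s <= b -> 0 < 'D_v F (p + s *: v)) ->
  F (p + a *: v) < F (p + b *: v).
Proof.
move=> ab dF D0.
have hd s : a <= s <= b ->
    is_derive s 1 (fun t => F (p + t *: v)) ('D_v F (p + s *: v)).
  by move=> hs; apply: is_derive_line; exact: dF.
have [] := @MVT_segment R (fun t => F (p + t *: v)) (fun s => 'D_v F (p + s *: v)) a b.
- exact: ltW.
- by move=> s; rewrite in_itv /= => /andP[h1 h2]; apply: hd; rewrite !ltW.
- apply: derivable_within_continuous => s; rewrite in_itv /= => hs.
  by have [] := hd s hs.
move=> c; rewrite in_itv /= => hc e.
by rewrite -subr_gt0 e mulr_gt0 // ?subr_gt0 // D0.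
Qed.

Lemma line_IVT F p v (a b y : R) : a <= b ->
  (forall s, a <= s <= b -> differentiable F (p + s *: v)) ->
  F (p + a *: v) <= y <= F (p + b *: v) ->
  exists2 s, a <= s <= b & F (p + s *: v) = y.
Proof.
move=> ab dF /andP[h1 h2].
have [] := @IVT R (fun t => F (p + t *: v)) a b y ab.
- apply: derivable_within_continuous => s; rewrite in_itv /= => hs.
  by have [] := is_derive_line (dF s hs).
- by rewrite ge_min le_max h1 h2 orbT.
by move=> c; rewrite in_itv /= => hc e; exists c.
Qed.

Lemma Cks_upd k (V : set 'rV[R]_d) j h i : open V -> Cks k V h ->
  Cks k V (fun q => upd q j (h q) 0 i).
Proof.
move=> oV hh; under [X in Cks _ _ X]eq_fun do rewrite mxE.
by case: eqP => _ //; exact: Cks_coord.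
Qed.

Lemma continuous_upd j a : continuous (fun q => upd q j a).
Proof.
move=> q; apply: continuous_row_mx => i.
have : Cks 0 setT (fun q => upd q j a 0 i).
  by apply: Cks_upd; [exact: openT | apply: Cks_cst; exact: openT].
exact.
Qed.

Lemma open_norm (U : set 'rV[R]_d) p : open U -> U p ->
  exists2 e, 0 < e & forall q, `|q - p| < e -> U q.
Proof.
move=> oU Up; have /nbhs_ballP[e /= e0 he] : nbhs p U by exact: open_nbhs_nbhs.
exists e => // q hq; apply: he.
by rewrite -ball_normE /ball_ /= distrC.
Qed.

(** * Regularity of the inverse of [p |-> upd p j (F p)], whose [j]-th coordinate is [h] *)

Section Inverse.
Variables (j : 'I_d) (U V : set 'rV[R]_d) (F h : 'rV[R]_d -> R).
Hypothesis (oU : open U) (oV : open V).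
Hypothesis sF : smooth U F.
Hypothesis F_incr : forall p, U p -> 0 < 'D_(delta_mx 0 j) F p.
Hypothesis inj : forall p p', U p -> U p' ->
  upd p j (F p) = upd p' j (F p') -> p = p'.
Hypothesis hU : forall q, V q -> U (upd q j (h q)).
Hypothesis hF : forall q, V q -> F (upd q j (h q)) = q 0 j.

Let dF p : U p -> differentiable F p.
Proof. by move=> Up; have [+ _] := sF 1%N; exact. Qed.

Lemma fiber_inverse_uniq q s : V q -> U (upd q j s) -> F (upd q j s) = q 0 j ->
  h q = s.
Proof.
move=> Vq Us Fs; have : upd q j (h q) = upd q j s.
  by apply: inj => //; [exact: hU | rewrite hF // Fs !upd_upd].
by move=> /rowP/(_ j); rewrite !updj.
Qed.

(** By monotonicity the values of [F] at [h q - t] and [h q + t] on the fibre strictly bracket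
    [q 0 j], and still do so for nearby [q']. The intermediate value theorem gives a solution within
    [t] of [h q], and uniqueness identifies it with [h q']. *)
Lemma fiber_inverse_continuous q : V q -> {for q, continuous h}.
Proof.
move=> Vq; rewrite /prop_for /continuous_at.
apply/(cvgrPdist_le (FF := nbhs_filter q)) => /= e e0.
set p := upd q j (h q); have Up : U p by exact: hU.
have [dl dl0 hdl] := open_norm oU Up.
(* Halving [dl] keeps the closed segments of radius [t] inside the open ball of radius [dl], hence
   inside [U]. *)
pose t := Num.min e (dl / 2).
have t0 : 0 < t by rewrite lt_min e0 divr_gt0.
have tdl : t < dl by rewrite gt_min; apply/orP; right; lra.
have te : t <= e by rewrite ge_min lexx.
have near_U q' s : `|q' - q| < dl -> `|s - h q| <= t -> U (upd q' j s).
  move=> hq' hs; apply: hdl.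
  apply: (@le_lt_trans _ _ (Num.max `|q' - q| t)); last by rewrite gt_max hq'.
  apply: norm_le_coord => [|i]; first by rewrite le_max normr_ge0.
  rewrite !mxE le_max; case: eqP => _; first by rewrite hs orbT.
  by have := coord_le_norm (q' - q) i; rewrite !mxE => ->.
have UL q' s : `|q' - q| < dl -> `|s - h q| <= t ->
    U (upd q' j 0 + s *: delta_mx 0 j) by rewrite -upd_line; exact: near_U.
have dist s : h q - t <= s <= h q + t -> `|s - h q| <= t.
  by rewrite ler_distl.
have q0 : `|q - q| < dl by rewrite subrr normr0.
have lo : F (upd q j (h q - t)) < q 0 j.
  rewrite -[ltRHS]hF // (upd_line q j (h q - t)) (upd_line q j (h q)); apply: line_increasing.
  - by rewrite ltrBlDr ltrDl.
  - move=> s /andP[h1 h2]; apply/dF/UL => //; apply: dist; rewrite h1 /=; lra.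
  - move=> s /andP[h1 h2]; apply/F_incr/UL => //; apply: dist; rewrite h1 /=; lra.
have hi : q 0 j < F (upd q j (h q + t)).
  rewrite -[ltLHS]hF // (upd_line q j (h q + t)) (upd_line q j (h q)); apply: line_increasing.
  - by rewrite ltrDl.
  - move=> s /andP[h1 h2]; apply/dF/UL => //; apply: dist; rewrite h2 andbT; lra.
  - move=> s /andP[h1 h2]; apply/F_incr/UL => //; apply: dist; rewrite h2 andbT; lra.
have cF s : `|s - h q| <= t -> {for q, continuous (fun q' => F (upd q' j s) - q' 0 j)}.
  move=> hs; apply: continuousB; last exact: coord_continuous.
  apply: continuous_comp; first exact: continuous_upd.
  by apply: differentiable_continuous; apply/dF/near_U.
have n1 : \forall q' \near q, F (upd q' j (h q - t)) - q' 0 j < 0.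
  apply: (cvgr_lt _ (cF (h q - t) _)); last by rewrite subr_lt0.
  by apply: dist; lra.
have n2 : \forall q' \near q, 0 < F (upd q' j (h q + t)) - q' 0 j.
  apply: (cvgr_gt _ (cF (h q + t) _)); last by rewrite subr_gt0.
  by apply: dist; lra.
have n3 : \forall q' \near q, `|q' - q| < dl.
  apply/nbhs_ballP; exists dl => //= q'; rewrite -ball_normE /ball_ /= => ?.
  by rewrite distrC.
have n4 : \forall q' \near q, V q' by exact: open_nbhs_nbhs.
near=> q'.
have Vq' : V q' by exact: (near n4).
have hq' : `|q' - q| < dl by exact: (near n3 q').
have l1 : F (upd q' j (h q - t)) - q' 0 j < 0 by exact: (near n1 q').
have l2 : 0 < F (upd q' j (h q + t)) - q' 0 j by exact: (near n2 q').
have [|||s hs es] := @line_IVT F (upd q' j 0) (delta_mx 0 j) (h q - t) (h q + t) (q' 0 j).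
- lra.
- by move=> s hs; apply/dF/UL => //; exact: dist.
- by rewrite -!upd_line; apply/andP; split; lra.
have -> : h q' = s.
  apply: fiber_inverse_uniq => //; last by rewrite upd_line.
  by apply: near_U => //; exact: dist.
by rewrite distrC (le_trans _ te) // dist.
Unshelve. all: by end_near. Qed.

(** Implicit differentiation of [F (upd q j (h q)) = q 0 j]: the preimage moves in the direction
    [v + (Dh v - v 0 j) e_j], so [D_v F + (Dh v - v 0 j) a = v 0 j], which is solved for [Dh v]. *)
Lemma fiber_inverse_derivs q : V q ->
  let a := 'D_(delta_mx 0 j) F (upd q j (h q)) in
  has_derivs h q (fun v => (v 0 j + v 0 j * a - 'D_v F (upd q j (h q))) / a).
Proof.
move=> Vq a; set p := upd q j (h q).
have Up : U p by exact: hU.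
have a0 : 0 < a by exact: F_incr.
have dFp := dF Up.
pose g (v : 'rV[R]_d) := (v 0 j + v 0 j * a - 'D_v F p) * a^-1.
have hg : has_derivs g 0 g.
  have hL : has_derivs (fun v => 'D_v F p) 0 (fun v => 'D_v F p).
    have e : (fun v => 'D_v F p) = (fun v => \sum_(i < d) v 0 i * 'D_(delta_mx 0 i) F p).
      by apply/funext => v; exact: row_sum_derive.
    rewrite e; apply: has_derivs_eq (has_derivs_sum _ _) _ => [i _|v].
      exact: has_derivsM (has_derivs_coord i 0) (has_derivs_cst _ 0).
    by apply: eq_bigr => i _; rewrite mulr0 add0r mulrC.
  have hc := has_derivs_coord j (0 : 'rV[R]_d).
  have cst c := has_derivs_cst c (0 : 'rV[R]_d).
  apply: has_derivs_eq (has_derivsM (has_derivsB (has_derivsD hc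
    (has_derivsM hc (cst a))) hL) (cst a^-1)) _ => v.
  by rewrite /g /=; ring.
have [dg Dg] := hg.
(* The candidate [g] is its own differential at 0; ['d g 0] thus supplies it as a bundled continuous
   linear map. *)
have [L [cL eL]] : exists L : {linear 'rV[R]_d -> R},
    continuous L /\ forall v, L v = g v.
  exists ('d g 0); split; first exact: diff_continuous.
  by move=> v; rewrite -(deriveE _ dg) Dg.
suff [dh eh] : differentiable h q /\ 'd h q = L :> ('rV[R]_d -> R).
  split; first exact: dh.
  by move=> v; rewrite (deriveE _ dh) eh eL.
apply: approx_differentiable; first exact: cL.
move=> e' e'0.
have [C C0 hC] : exists2 C, 0 < C & forall v, `|g v| <= C * `|v|.
  have [C C0 hC] := linear_lipschitz cL.
  by exists C => // v; rewrite -eL.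
(* The bound [e <= a / 2] absorbs half of [|w k|] and leaves [|w k| <= 2 (2 + C) |k|]; the second
   bound then turns the error [e |w k| / a] into at most [e' |k|]. *)
pose e := Num.min (a / 2) (e' * a / (2 * (2 + C))).
have e0 : 0 < e by rewrite lt_min !divr_gt0 ?mulr_gt0 // addr_gt0.
have e1 : e <= a / 2 by rewrite ge_min lexx.
have e2 : e <= e' * a / (2 * (2 + C)) by rewrite ge_min lexx orbT.
have approx := differentiable_approx dFp e0.
(* The displacement of the preimage [upd q j (h q)] when [q] moves by [k]. Continuity of [h] makes
   it tend to 0, so that the expansion of [F] at [p] can be used along it. *)
pose w (k : 'rV[R]_d) : 'rV[R]_d := k + (h (k + q) - h q - k 0 j) *: delta_mx 0 j.
have wE k : upd (k + q) j (h (k + q)) = w k + p.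
  apply/rowP => i; rewrite !mxE /=; case: eqP => [->|_] /=.
    by rewrite mulr1; ring.
  by rewrite mulr0 addr0.
have cw : w k @[k --> (0 : 'rV[R]_d)] --> (0 : 'rV[R]_d).
  have ch : {for (0 : 'rV[R]_d), continuous (fun k : 'rV[R]_d => h (k + q))}.
    apply: continuous_comp; first by apply: (@continuousD _ _ _ id (cst q));
      [exact: cvg_id | exact: cst_continuous].
    by rewrite add0r; exact: fiber_inverse_continuous.
  have : {for (0 : 'rV[R]_d), continuous w}.
    have ceta : {for (0 : 'rV[R]_d),
        continuous (fun k : 'rV[R]_d => h (k + q) - h q - k 0 j)}.
      apply: (@continuousB _ _ _ (fun k : 'rV[R]_d => h (k + q) - h q));
        last exact: coord_continuous.
      apply: (@continuousB _ _ _ (fun k : 'rV[R]_d => h (k + q)) (cst (h q))) => //.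
      exact: cst_continuous.
    apply: (@continuousD _ _ _ id); first exact: cvg_id.
    exact: continuousZr_tmp.
  have w0 : w 0 = 0 by rewrite /w !add0r subrr mxE subrr scale0r.
  by rewrite /prop_for /continuous_at w0.
have n1 : \forall k \near (0 : 'rV[R]_d), `|F (w k + p) - F p - 'd F p (w k)| <= e * `|w k|.
  exact: (cw _ approx).
have n2 : nbhs (0 : 'rV[R]_d) (fun k : 'rV[R]_d => V (k + q)).
  have /nbhs0P : nbhs q V by exact: open_nbhs_nbhs.
  by apply: filterS => k; rewrite addrC.
near=> k.
have Vk : V (k + q) by exact: (near n2 k).
have : `|F (w k + p) - F p - 'd F p (w k)| <= e * `|w k| by exact: (near n1 k).
have -> : F (w k + p) = k 0 j + q 0 j by rewrite -wE hF // mxE.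
have -> : F p = q 0 j by exact: hF.
rewrite eL addrK.
have -> : 'd F p (w k) = 'D_k F p + (h (k + q) - h q - k 0 j) * a.
  by rewrite /w linearD linearZ -!(deriveE _ dFp).
set eta := h (k + q) - h q => hE.
have eta_g : `|eta - g k| <= e * `|w k| / a.
  rewrite ler_pdivlMr // -[X in _ * X <= _](gtr0_norm a0) -normrM.
  have -> : (eta - g k) * a = - (k 0 j - ('D_k F p + (eta - k 0 j) * a)).
    by rewrite /g; field; rewrite gt_eqF.
  by rewrite normrN.
have hw : `|w k| <= 2 * `|k| + `|eta|.
  apply: (@le_trans _ _ (`|k| + `|eta - k 0 j|)).
    apply: (le_trans (ler_normD _ _)); rewrite lerD2l.
    apply: norm_le_coord => // i; rewrite !mxE /= normrM.
    by case: (i == j); rewrite ?normr1 ?mulr1 // normr0 mulr0.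
  have := ler_normB eta (k 0 j); have := coord_le_norm k j; lra.
have heta : `|eta| <= C * `|k| + e * `|w k| / a.
  have := ler_normD (g k) (eta - g k); rewrite addrC subrK.
  by have := hC k; lra.
have hea : e * `|w k| / a <= `|w k| / 2.
  rewrite ler_pdivrMr // mulrAC -mulrA [_ * (_ / _)]mulrC.
  by have := ler_wpM2r (normr_ge0 (w k)) e1; lra.
have hwk : `|w k| <= 2 * (2 + C) * `|k| by lra.
apply: (le_trans eta_g); rewrite ler_pdivrMr //.
have C2 : 0 < 2 * (2 + C) by rewrite mulr_gt0 // addr_gt0.
apply: (@le_trans _ _ (e' * a / (2 * (2 + C)) * (2 * (2 + C) * `|k|))).
  by apply: ler_pM => //; exact: ltW.
by rewrite mulrA divfK ?gt_eqF // mulrAC.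
Unshelve. all: by end_near. Qed.

(** Bootstrapping: the derivative formula involves [h] only through derivatives of [F] at
    [upd q j (h q)], so its regularity is at least that of [h], and [h] gains one order at each
    turn. *)
Lemma fiber_inverse_smooth : smooth V h.
Proof.
elim=> [|k IH]; first exact: fiber_inverse_continuous.
have hcomp f : smooth U f -> Cks k V (fun q => f (upd q j (h q))).
  move=> sf; apply: (Cks_comp (V := U)) (sf k) => //.
  by move=> i; exact: Cks_upd.
have sD v : smooth U (fun p => 'D_v F p) by move=> m; exact: Cks_deriv (sF m.+1).
apply: (CksS oV fiber_inverse_derivs) => v /=.
apply: Cks_div => //.
- by move=> q Vq; rewrite gt_eqF // F_incr //; exact: hU.
- apply: CksB => //; last exact: (hcomp _ (sD v)).
  apply: CksD => //; first exact: Cks_cst.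
  by apply: CksM => //; [exact: Cks_cst | exact: (hcomp _ (sD _))].
- exact: (hcomp _ (sD _)).
Qed.

End Inverse.

End FiberwiseInverse.

(** * A smooth cut-off of the logarithm *)

Section FlatFunctions.
Context {R : realType}.
Implicit Types (p : {poly R}) (t u : R).

(** Induction along Horner's scheme: the factor [u] gained at each step is absorbed by half of the
    exponential, as [u <= (2 / a) exp (a u / 2)]. *)
Lemma poly_le_expR p (a : R) : 0 < a ->
  exists2 C, 0 < C & forall u, 0 < u -> `|p.[u]| <= C * expR (a * u).
Proof.
elim/poly_ind: p a => [|p c IH] a a0.
  by exists 1 => // u _; rewrite horner0 normr0 mul1r expR_ge0.
have [|C C0 hC] := IH (a / 2); first by rewrite divr_gt0.
exists (C * (2 / a) + `|c|) => [|u u0].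
  by rewrite ltr_pwDl // mulr_gt0 // divr_gt0.
rewrite hornerMXaddC; apply: (le_trans (ler_normD _ _)).
rewrite mulrDl lerD //; last first.
  by rewrite ler_peMr // -expR0 ler_expR mulr_ge0 // ltW.
rewrite normrM (gtr0_norm u0).
have h1 : u <= 2 / a * expR (a / 2 * u).
  rewrite mulrC -ler_pdivrMr ?divr_gt0 // invf_div mulrC.
  by have := expR_ge1Dx (a / 2 * u); lra.
have -> : a * u = a / 2 * u + a / 2 * u by field.
rewrite expRD.
have -> : C * (2 / a) * (expR (a / 2 * u) * expR (a / 2 * u)) =
  (C * expR (a / 2 * u)) * (2 / a * expR (a / 2 * u)) by ring.
by apply: ler_pM => //; [exact: ltW | exact: hC].
Qed.

(** The polynomial parameter closes the family under differentiation: for [t > 0] the derivative of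
    [p(1/t) exp(-1/t)] is [t^-2 (p - p')(1/t) exp(-1/t)]. Smoothness of all orders then follows from
    [Cks_fam]. *)
Definition flatp p t : R := if 0 < t then p.[t^-1] * expR (- t^-1) else 0.

Lemma flatp_le0 p t : t <= 0 -> flatp p t = 0.
Proof. by move=> h; rewrite /flatp ltNge h. Qed.

Lemma flatp_bounded p : exists2 C, 0 < C & forall t, `|flatp p t| <= C.
Proof.
have [C C0 hC] := poly_le_expR p (@ltr01 R).
exists C => // t; rewrite /flatp; case: ltP => t0; last by rewrite normr0 ltW.
have := hC t^-1; rewrite invr_gt0 => /(_ t0); rewrite mul1r => h.
by rewrite normrM (gtr0_norm (expR_gt0 _)) expRN ler_pdivrMr ?expR_gt0.
Qed.

(** Boundedness of [flatp (p * 'X^2)] is boundedness of [flatp p t / t^2] for [t > 0]. The quadratic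
    decay yields the zero derivative at the gluing point 0. *)
Lemma flatp_sqr p : exists2 C, 0 < C & forall t, `|flatp p t| <= C * t ^+ 2.
Proof.
have [C C0 hC] := flatp_bounded (p * 'X^2).
exists C => // t; have := hC t; rewrite /flatp.
case: ltP => t0; last by rewrite normr0 mulr_ge0 ?sqr_ge0 // ltW.
rewrite hornerM hornerXn mulrAC normrM => h.
have t2 : 0 < t ^+ 2 by rewrite exprn_gt0.
rewrite -ler_pdivrMr //; move: h.
by rewrite [X in _ * X <= _]gtr0_norm ?exprn_gt0 ?invr_gt0 // exprVn.
Qed.

Lemma is_derive_flatp p t : is_derive t 1 (flatp p) (flatp ('X^2 * (p - p^`())) t).
Proof.
have [t0|t0|->] := ltgtP t 0.
- rewrite [X in is_derive _ _ _ X]flatp_le0 ?ltW //.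
  have hc : is_derive t 1 (cst (0 : R)) (0 : R) by exact: is_derive_cst.
  apply: near_eq_is_derive hc.
  near=> s; rewrite flatp_le0 //; apply: ltW; near: s; exact: lt_nbhsl.
- have e : \near t, (fun s => p.[s^-1] * expR (- s^-1)) t = flatp p t.
    by near=> s; rewrite /flatp ifT //; near: s; exact: lt_nbhsr.
  apply: near_eq_is_derive e _.
  have tn0 : t != 0 by rewrite gt_eqF.
  have dV : is_derive t 1 (fun s : R => s^-1) (- t^-1 ^+ 2).
    apply: is_derive_eq; first exact: is_deriveV.
    by rewrite [_ *: _]mulr1 exprVn.
  have dp : is_derive t 1 (fun s : R => p.[s^-1]) (- t^-1 ^+ 2 * (p^`()).[t^-1]).
    apply: is_derive_eq (@is_derive1_comp _ (horner p) _ t _ _ (is_derive_poly p t^-1) dV) _.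
    by rewrite mulrC derivE.
  have de : is_derive t 1 (fun s : R => expR (- s^-1)) (expR (- t^-1) * t^-1 ^+ 2).
    apply: is_derive_eq (@is_derive1_comp _ expR _ t _ _ (is_derive_expR _) (is_deriveN dV)) _.
    by rewrite opprK.
  apply: is_derive_eq (is_deriveM dp de) _.
  rewrite /flatp t0 hornerM hornerXn hornerD hornerN /= -![_ *: _]/(_ * _).
  ring.
- rewrite [X in is_derive _ _ _ X]flatp_le0 //.
  have [C C0 hC] := flatp_sqr p.
  suff h : h^-1 *: ((flatp p \o shift 0) (h *: (1 : R)) - flatp p 0) @[h --> 0^'] --> (0 : R).
    by split; [apply/cvg_ex; exists 0 | exact/cvg_lim].
  apply/cvgrPdist_le => /= e e0; near=> h.
  rewrite sub0r normrN [flatp p 0]flatp_le0 // subr0 addr0 [h *: 1]mulr1.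
  have h0 : h != 0 by near: h; exact: nbhs_dnbhs_neq.
  rewrite [_ *: _]/(_ * _) normrM normfV ler_pdivrMl ?normr_gt0 //.
  apply: (le_trans (hC h)); rewrite -real_normK ?num_real // expr2.
  rewrite mulrCA ler_wpM2l // mulrC -ler_pdivlMr //.
  by near: h; apply: dnbhs0_le; rewrite divr_gt0.
Unshelve. all: by end_near. Qed.

Lemma Cks_flatp d k (U : set 'rV[R]_d) f p : open U -> Cks k U f ->
  Cks k U (fun q => flatp p (f q)).
Proof.
move=> oU hf.
apply: (@Cks_fam _ _ {poly R} flatp setT (fun p => flatp ('X^2 * (p - p^`())))
   _ _ oU _ _ _ k hf p) => //.
by move=> p' x _; exact: is_derive_flatp.
Qed.

End FlatFunctions.

Section Profile.
Context {R : realType}.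
Implicit Types D : R.

(** For [D < 1] this is [exp (- 1 / (1 - D))]; [bump1] and [bump2] are [- bump'] and [bump'']. *)
Definition bump D : R := flatp 1 (1 - D).
Definition bump1 D : R := flatp 'X^2 (1 - D).
Definition bump2 D : R := flatp ('X^2 * ('X^2 - ('X^2)^`())) (1 - D).
Definition den D : R := D + bump D.
(** For [D > 0] this is [ln (1 + bump D / D)]: it vanishes with [bump] and behaves like [- ln D]
    near 0, where [den] stays positive. *)
Definition G D : R := ln (den D) - ln D.
(** This is [- D G'(D)], in a form that makes sense and stays bounded at [D = 0], where it equals 1;
    [K'] is its derivative. *)
Definition K D : R := (bump D + D * bump1 D) / den D.
Definition K' D : R :=
  (- D * bump2 D * den D - (bump D + D * bump1 D) * (1 - bump1 D)) / den D ^+ 2.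

Lemma flatp1E t : 0 < t -> flatp 1 t = expR (- t^-1) :> R.
Proof. by move=> t0; rewrite /flatp t0 hornerC mul1r. Qed.

Lemma bump_ge0 D : 0 <= bump D.
Proof.
rewrite /bump /flatp; case: ifP => // _.
by rewrite hornerC mul1r expR_ge0.
Qed.

Lemma bump1_ge0 D : 0 <= bump1 D.
Proof.
rewrite /bump1 /flatp; case: ifP => // h.
by rewrite hornerXn mulr_ge0 ?expR_ge0 // exprn_ge0 // invr_ge0 ltW.
Qed.

Lemma den_lb : exists2 c : R, 0 < c & forall D, 0 <= D -> c <= den D.
Proof.
(* If [D < 1/2] then [1 - D > 1/2], so [bump D] is at least [expR (- 2)]. *)
exists (Num.min (1 / 2) (expR (- 2))) => [|D D0].
  by rewrite lt_min expR_gt0 andbT; lra.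
rewrite ge_min /den; case: (leP (1 / 2) D) => hD.
  by rewrite (le_trans hD) // lerDl bump_ge0.
apply/orP; right; rewrite -[leLHS]add0r lerD // /bump flatp1E; last lra.
rewrite ler_expR lerN2 -[2]invrK lef_pV2 ?posrE; lra.
Qed.

Lemma den_gt0 D : 0 <= D -> 0 < den D.
Proof. by have [c c0 hc] := den_lb => /hc; exact: lt_le_trans. Qed.

Lemma is_derive_flat1B p D :
  is_derive D 1 (fun x => flatp p (1 - x)) (- flatp ('X^2 * (p - p^`())) (1 - D) : R).
Proof.
have h1 : is_derive D (1 : R) (fun x : R => 1 - x) (-1).
  exact: is_derive_eq (is_deriveB (is_derive_cst (1 : R) D 1) (is_derive_id D 1)) (sub0r _).
have h2 := is_derive_flatp p (1 - D).
apply: is_derive_eq (@is_derive1_comp _ (flatp p) _ D _ _ h2 h1) _.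
by rewrite mulrN1.
Qed.

Lemma is_derive_bump D : is_derive D 1 bump (- bump1 D).
Proof.
by apply: is_derive_eq (is_derive_flat1B 1 D) _; rewrite derivC subr0 mulr1.
Qed.

Lemma is_derive_bump1 D : is_derive D 1 bump1 (- bump2 D).
Proof. exact: is_derive_flat1B. Qed.

Lemma is_derive_den D : is_derive D 1 den (1 - bump1 D).
Proof.
have h := is_derive_bump D.
exact: is_derive_eq (is_deriveD (is_derive_id D 1) h) _.
Qed.

Lemma is_derive_G D : 0 < D -> is_derive D 1 G (- (K D / D)).
Proof.
move=> D0; have d0 : 0 < den D by rewrite den_gt0 // ltW.
have h1 := is_derive_den D.
have h2 : is_derive D 1 (fun x => ln (den x)) ((1 - bump1 D) / den D).
  apply: is_derive_eq (@is_derive1_comp _ (@ln R) den D _ _ (is_derive1_ln d0) h1) _.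
  by rewrite mulrC.
have h3 := is_derive1_ln D0.
apply: is_derive_eq (is_deriveB h2 h3) _.
rewrite /K /den; field; rewrite gt_eqF //=.
by rewrite -[D + bump D]/(den D) gt_eqF.
Qed.

Lemma is_derive_K D : 0 <= D -> is_derive D 1 K (K' D).
Proof.
move=> D0; have d0 := den_gt0 D0.
have h1 := is_derive_den D; have h2 := is_derive_bump D.
have h3 := is_derive_bump1 D.
have dn0 : den D != 0 by rewrite gt_eqF.
have h4 : is_derive D 1 (fun x => bump x + x * bump1 x) (- D * bump2 D).
  apply: is_derive_eq (is_deriveD h2 (is_deriveM (is_derive_id D 1) h3)) _.
  by rewrite /= -![_ *: _]/(_ * _); ring.
have h5 : is_derive D 1 (fun x => (den x)^-1) (- (1 - bump1 D) / den D ^+ 2).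
  apply: is_derive_eq (@is_deriveV _ den D _ _ dn0 h1) _.
  by rewrite -[_ *: _]/(_ * _); field.
apply: is_derive_eq (is_deriveM h4 h5) _.
by rewrite /K' -![_ *: _]/(_ * _); field.
Qed.

Lemma bump_ge1 D : 1 <= D -> [/\ bump D = 0, bump1 D = 0 & bump2 D = 0].
Proof. by move=> h; split; apply: flatp_le0; lra. Qed.

Lemma G_ge1 D : 1 <= D -> G D = 0.
Proof. by move=> /bump_ge1[h _ _]; rewrite /G /den h addr0 subrr. Qed.

Lemma K_ge1 D : 1 <= D -> K D = 0.
Proof. by move=> /bump_ge1[h h' _]; rewrite /K h h' mulr0 addr0 mul0r. Qed.

Lemma K'_ge1 D : 1 <= D -> K' D = 0.
Proof.
move=> /bump_ge1[h h' h'']; rewrite /K' h h' h''.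
by rewrite !mulr0 addr0 !mul0r subrr mul0r.
Qed.

Lemma K_ge0 D : 0 <= D -> 0 <= K D.
Proof.
move=> D0; rewrite /K divr_ge0 ?(ltW (den_gt0 D0)) //.
by rewrite addr_ge0 ?bump_ge0 // mulr_ge0 ?bump1_ge0.
Qed.

(** From 1 on both functions vanish; on [[0, 1]] the numerators are bounded and [den] is bounded
    below. As the bound reaches down to [D = 0], one [k] can serve a whole neighbourhood of the
    ray. *)
Lemma K_bounded : exists2 C : R, 0 < C &
  forall D, 0 <= D -> K D <= C /\ `|K' D| <= C.
Proof.
have [c c0 hc] := den_lb.
have [B B0 hB] := @flatp_bounded R 1.
have [B1 B10 hB1] := @flatp_bounded R 'X^2.
have [B2 B20 hB2] := @flatp_bounded R ('X^2 * ('X^2 - ('X^2)^`())).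
pose C := (B + B1) / c + (B2 / c + (B + B1) * (1 + B1) / c ^+ 2).
have C0 : 0 < C by rewrite !addr_gt0 // !divr_gt0 ?mulr_gt0 ?exprn_gt0 ?addr_gt0.
exists C => // D D0; case: (leP 1 D) => D1.
  by rewrite K_ge1 // K'_ge1 // normr0 ltW.
have d0 := den_gt0 D0; have hd := hc D D0.
have b0 := bump_ge0 D; have b10 := bump1_ge0 D.
have bB : bump D <= B by rewrite -[leLHS]ger0_norm //; exact: hB.
have b1B : bump1 D <= B1 by rewrite -[leLHS]ger0_norm //; exact: hB1.
have b2B : `|bump2 D| <= B2 by exact: hB2.
have hn0 : 0 <= bump D + D * bump1 D by rewrite addr_ge0 // mulr_ge0.
have hn : bump D + D * bump1 D <= B + B1.
  by apply: lerD => //; rewrite -[leRHS]mul1r ler_pM // ltW.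
have hK : K D <= (B + B1) / c.
  by rewrite /K ler_pM // ?invr_ge0 ?(ltW d0) // lef_pV2 // posrE.
have hK' : `|K' D| <= B2 / c + (B + B1) * (1 + B1) / c ^+ 2.
  have -> : K' D = - (D * bump2 D) / den D
      - (bump D + D * bump1 D) * (1 - bump1 D) / den D ^+ 2.
    by rewrite /K'; field; rewrite gt_eqF.
  apply: (le_trans (ler_normB _ _)); apply: lerD.
    rewrite normrM normrN normfV (gtr0_norm d0).
    apply: ler_pM => //; rewrite ?invr_ge0 ?(ltW d0) //.
      by rewrite normrM (ger0_norm D0) -[leRHS]mul1r ler_pM // ltW.
    by rewrite lef_pV2 // posrE.
  rewrite !normrM normfV (ger0_norm hn0) normrX (gtr0_norm d0).
  apply: ler_pM; rewrite ?mulr_ge0 ?invr_ge0 ?exprn_ge0 ?(ltW d0) //.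
    apply: ler_pM => //; apply: (le_trans (ler_normB _ _)).
    by rewrite normr1 (ger0_norm b10) lerD2l.
  by rewrite lef_pV2 ?posrE ?exprn_gt0 // lerXn2r // nnegrE ltW.
have p1 : 0 < (B + B1) / c by rewrite divr_gt0 // addr_gt0.
have p2 : 0 < B2 / c by rewrite divr_gt0.
have p3 : 0 < (B + B1) * (1 + B1) / c ^+ 2.
  by rewrite divr_gt0 ?exprn_gt0 // mulr_gt0 // addr_gt0.
by split; rewrite /C; lra.
Qed.

(** Quantifies the divergence at 0 that lets [genX] reach arbitrarily large values at the tip of the
    ray. *)
Lemma G_lb : exists c : R, forall D, 0 < D -> c - ln D <= G D.
Proof.
have [c c0 hc] := den_lb; exists (ln c) => D D0.
rewrite /G lerD2r ler_ln ?posrE //; first exact/hc/ltW.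
exact/den_gt0/ltW.
Qed.

Section ProfileSmooth.
Context {d : nat}.
Variables (k : nat) (U : set 'rV[R]_d) (f : 'rV[R]_d -> R).
Hypothesis (oU : open U) (f0 : forall p, U p -> 0 < f p) (sf : Cks k U f).

Let Cks_den : Cks k U (fun p => den (f p)).
Proof.
apply: CksD => //; apply: Cks_flatp => //.
by apply: CksB => //; exact: Cks_cst.
Qed.

Lemma Cks_G : Cks k U (fun p => G (f p)).
Proof.
apply: CksB => //; apply: Cks_ln => // p Up.
by apply/den_gt0/ltW/f0.
Qed.

Lemma Cks_K : Cks k U (fun p => K (f p)).
Proof.
have h : Cks k U (fun p => 1 - f p) by apply: CksB => //; exact: Cks_cst.
apply: Cks_div => //.
  by move=> p Up; rewrite gt_eqF //; apply/den_gt0/ltW/f0.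
by apply: CksD => //; [|apply: CksM => //]; exact: Cks_flatp.
Qed.

End ProfileSmooth.

End Profile.

(** * The generating function and its partial derivatives *)

Section GeneratingFunction.
Context {R : realType}.
Implicit Types (x y q M k : R).

Definition rho x y q : R := Num.sqrt (x ^+ 6 + y ^+ 2 + q).
Definition gap x y q : R := rho x y q - x ^+ 3.
Definition lev M x y q : R := M * (1 + x ^+ 6) * gap x y q.
(** Minus the logarithmic [x]-derivative of [lev]. The [x]-derivative of [gap] is
    [- 3 x^2 gap / rho], so [gap] cancels and no singularity along the ray beyond its tip
    remains. *)
Definition slope x y q : R := 3 * x ^+ 2 / rho x y q - 6 * x ^+ 5 / (1 + x ^+ 6).

(** Since [G' = - K / D], the partial derivatives of [k y G(lev)] need only [K] and logarithmic
    derivatives of [lev]; those in [y] and [q] are [y / (rho gap)] and [1 / (2 rho gap)]. *)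
Definition genY M k x y q : R := y + k * (y * K (lev M x y q) * slope x y q).
Definition genX M k x y q : R :=
  x + k * (G (lev M x y q) - K (lev M x y q) * y ^+ 2 / (rho x y q * gap x y q)).
Definition genA M k x y q : R :=
  k * (K (lev M x y q) * y / (rho x y q * gap x y q)).

Definition off_ray x y q := 0 <= q /\ (0 < y ^+ 2 + q \/ x < 0).

Lemma x6_ge0 x : 0 <= x ^+ 6.
Proof. by rewrite -[6%N]/(2 * 3)%N exprM exprn_ge0 // sqr_ge0. Qed.

Lemma x6_gt0 x : 0 < 1 + x ^+ 6.
Proof. by have := x6_ge0 x; lra. Qed.

Lemma off_rayP x y q : off_ray x y q ->
  [/\ 0 < rho x y q, 0 < gap x y q, rho x y q ^+ 2 = x ^+ 6 + y ^+ 2 + q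
    & `|x ^+ 3| <= rho x y q].
Proof.
case=> q0 h; have x60 := x6_ge0 x; have y0 := sqr_ge0 y.
have r2 : rho x y q ^+ 2 = x ^+ 6 + y ^+ 2 + q by rewrite sqr_sqrtr; lra.
have x3 : `|x ^+ 3| ^+ 2 = x ^+ 6 by rewrite real_normK ?num_real // -exprM.
have r_ge : `|x ^+ 3| <= rho x y q.
  by rewrite -(@ler_pXn2r _ 2) ?nnegrE ?sqrtr_ge0 // r2 x3; lra.
have r_gt : 0 < y ^+ 2 + q -> `|x ^+ 3| < rho x y q.
  by move=> h'; rewrite -(@ltr_pXn2r _ 2) ?nnegrE ?sqrtr_ge0 // r2 x3; lra.
case: h => [/r_gt h|xn].
  have := normr_ge0 (x ^+ 3); have := ler_norm (x ^+ 3).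
  by split => //; rewrite /gap; lra.
have h3 : x ^+ 3 < 0 by rewrite exprn_odd_lt0.
move: (r_ge); rewrite ltr0_norm // => h'.
by split => //; rewrite /gap; lra.
Qed.

(** A difference of squares. It replaces the cancellation in [gap] for large positive [x] by a
    quotient. *)
Lemma rho_gap x y q : off_ray x y q ->
  y ^+ 2 + q = gap x y q * (rho x y q + x ^+ 3).
Proof.
move=> h; have [_ _ r2 _] := off_rayP h.
have -> : gap x y q * (rho x y q + x ^+ 3) = rho x y q ^+ 2 - x ^+ 6 by rewrite /gap; ring.
by rewrite r2; ring.
Qed.

Lemma lev_gt0 M x y q : 0 < M -> off_ray x y q -> 0 < lev M x y q.
Proof.
by move=> M0 /off_rayP[_ s0 _ _]; rewrite !mulr_gt0 // x6_gt0.
Qed.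

(** This and the next definitions are differentials evaluated on a tangent vector with components
    [(dx, dy, dq)]. With explicit formulas, closedness becomes an identity that [field] can
    decide. *)
Definition drho x y q dx dy dq : R :=
  (6 * x ^+ 5 * dx + 2 * y * dy + dq) / (2 * rho x y q).
Definition dgap x y q dx dy dq : R := drho x y q dx dy dq - 3 * x ^+ 2 * dx.
Definition dlev M x y q dx dy dq : R :=
  M * (6 * x ^+ 5 * dx) * gap x y q + M * (1 + x ^+ 6) * dgap x y q dx dy dq.
Definition dslope x y q dx dy dq : R :=
  6 * x * dx / rho x y q - 3 * x ^+ 2 * drho x y q dx dy dq / rho x y q ^+ 2
  - (30 * x ^+ 4 / (1 + x ^+ 6) - 36 * x ^+ 10 / (1 + x ^+ 6) ^+ 2) * dx.
Definition drs x y q dx dy dq : R :=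
  drho x y q dx dy dq * gap x y q + rho x y q * dgap x y q dx dy dq.
Definition dgenY M k x y q dx dy dq : R :=
  dy + k * (dy * K (lev M x y q) * slope x y q
    + y * (K' (lev M x y q) * dlev M x y q dx dy dq) * slope x y q
    + y * K (lev M x y q) * dslope x y q dx dy dq).
Definition dgenX M k x y q dx dy dq : R :=
  dx + k * (- (K (lev M x y q) / lev M x y q) * dlev M x y q dx dy dq
    - K' (lev M x y q) * dlev M x y q dx dy dq * y ^+ 2 / (rho x y q * gap x y q)
    - K (lev M x y q) * (2 * y * dy / (rho x y q * gap x y q)
        - y ^+ 2 * drs x y q dx dy dq / (rho x y q * gap x y q) ^+ 2)).
Definition dgenA M k x y q dx dy dq : R :=
  k * (K' (lev M x y q) * dlev M x y q dx dy dq * y / (rho x y q * gap x y q)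
    + K (lev M x y q) * (dy / (rho x y q * gap x y q)
        - y * drs x y q dx dy dq / (rho x y q * gap x y q) ^+ 2)).

(* d(genX) /\ dy - d(genA) /\ dq / 2 = dx /\ d(genY): this says that
   d(s_x dx + s_y dy + s_q dq) = 0 for s = k * y * G (lev M x y q), where
   genY = y + s_x, genX = x + s_y and genA = - 2 * s_q. *)
Lemma gen_closed M k x y q (a a' b b' c c' : R) : M != 0 -> off_ray x y q ->
  dgenX M k x y q a b c * b' - dgenX M k x y q a' b' c' * b
  - (dgenA M k x y q a b c * c' - dgenA M k x y q a' b' c' * c) / 2
  = a * dgenY M k x y q a' b' c' - a' * dgenY M k x y q a b c.
Proof.
move=> M0 h; have [r0 s0 r2 _] := off_rayP h.
have x60 := x6_gt0 x.
rewrite /dgenX /dgenA /dgenY /dslope /drs /dlev /dgap /drho /slope.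
(* Closedness holds for every profile, so the values of [K] and [K'] become free variables, as does
   [rho] below, and an identity between rational functions is left. *)
move: (K _) (K' _) => kk kk'; rewrite /lev.
move: r0 s0 r2; rewrite /gap; move: (rho x y q) => r r0 s0 r2.
have x6n : 1 + x ^+ 6 != 0 by rewrite gt_eqF.
have rn : r != 0 by rewrite gt_eqF.
have sn : r - x ^+ 3 != 0 by rewrite gt_eqF.
field.
by rewrite ?M0 ?x6n ?rn ?sn.
Qed.


Lemma dgenX_x M k x y q : M != 0 -> off_ray x y q ->
  dgenX M k x y q 1 0 0 = dgenY M k x y q 0 1 0.
Proof.
move=> M0 h; have := gen_closed k 1 0 0 1 0 0 M0 h.
by rewrite !mulr1 !mulr0 !mul1r !mul0r !subr0 mul0r subr0.
Qed.

Lemma mu_bound x : `|6 * x ^+ 5 / (1 + x ^+ 6)| <= 6.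
Proof.
have h := x6_gt0 x; rewrite normrM normfV (gtr0_norm h) ler_pdivrMr //.
rewrite normrM ger0_norm // ler_wpM2l // normrX.
have -> : x ^+ 6 = `|x| ^+ 6 by rewrite -normrX ger0_norm // x6_ge0.
have := normr_ge0 x; move: `|x| => a a0; case: (leP a 1) => a1.
  have : a ^+ 5 <= 1 by rewrite exprn_ile1.
  by have := x6_ge0 a; lra.
have : a ^+ 5 <= a ^+ 6 by rewrite ler_weXn2l // ltW.
lra.
Qed.

Lemma slope_main_ge0 x y q : 0 <= 3 * x ^+ 2 / rho x y q.
Proof.
apply: divr_ge0; last exact: sqrtr_ge0.
by apply: mulr_ge0 => //; exact: sqr_ge0.
Qed.

(** The term [3 x^2 / rho] is unbounded near the origin but nonnegative, so only the upper bound
    suffers from it. *)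
Lemma slope_bounds x y q :
  -6 <= slope x y q /\ `|slope x y q| <= 3 * x ^+ 2 / rho x y q + 6.
Proof.
have h1 := slope_main_ge0 x y q.
have := mu_bound x; rewrite ler_norml => /andP[h2 h3].
by rewrite /slope ler_norml; split; lra.
Qed.

(** The quantity is [y * lev_y * slope], the coefficient of [K'] in the [y]-derivative of [genY].
    From [lev <= 1] and [rho + x^3 <= 2 rho] follows [M (1 + x^6) y^2 <= 2 rho], which controls the
    bounded part of [slope]. For the term [3 x^2 / rho]: if [|x| >= 1] it is at most 3; otherwise
    [y^2 <= rho^2] and [1 + x^6 <= 2] suffice. *)
Lemma slope_lev_bound M x y q : 0 < M -> off_ray x y q -> lev M x y q <= 1 ->
  `|M * (1 + x ^+ 6) * y ^+ 2 / rho x y q * slope x y q| <= 18 + 6 * M.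
Proof.
move=> M0 h l1; have [r0 s0 r2 rx] := off_rayP h.
have [_ hs] := slope_bounds x y q.
set r := rho x y q in r0 r2 rx hs *.
have m0 : 0 < M * (1 + x ^+ 6) by rewrite mulr_gt0 // x6_gt0.
set m := M * (1 + x ^+ 6) in m0 *.
have my : m * y ^+ 2 <= 2 * r.
  have q0 : 0 <= q by case: h.
  have e := rho_gap h.
  have h1 : m * y ^+ 2 <= m * (gap x y q * (r + x ^+ 3)).
    by rewrite ler_pM2l // -e; lra.
  apply: (le_trans h1); rewrite mulrA -[m * _]/(lev M x y q).
  have hr : r + x ^+ 3 <= 2 * r by have := ler_norm (x ^+ 3); lra.
  have hr0 : 0 <= r + x ^+ 3 by have := ler_normr (x ^+ 3); have := lerNnormlW rx; lra.
  apply: le_trans hr; rewrite -[leRHS]mul1r ler_wpM2r //.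
have my0 : 0 <= m * y ^+ 2 by rewrite mulr_ge0 ?sqr_ge0 // ltW.
rewrite normrM ger0_norm; last by rewrite divr_ge0 // ltW.
apply: (@le_trans _ _ (m * y ^+ 2 / r * (3 * x ^+ 2 / r + 6))).
  by rewrite ler_wpM2l // divr_ge0 // ltW.
have h2 : m * y ^+ 2 / r <= 2 by rewrite ler_pdivrMr.
have x20 : 0 <= 3 * x ^+ 2 / r by exact: slope_main_ge0.
suff h3 : m * y ^+ 2 / r * (3 * x ^+ 2 / r) <= 6 + 6 * M.
  rewrite mulrDr; lra.
have y0 := sqr_ge0 y.
case: (leP 1 `|x|) => hx.
  have : 3 * x ^+ 2 / r <= 3.
    rewrite ler_pdivrMr // ler_wpM2l // (le_trans _ rx) // normrX -real_normK ?num_real //.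
    by rewrite ler_weXn2l.
  move=> h3; apply: (@le_trans _ _ (2 * 3)); last by lra.
  by apply: ler_pM => //; rewrite divr_ge0 // ltW.
have -> : m * y ^+ 2 / r * (3 * x ^+ 2 / r) = 3 * x ^+ 2 * m * (y ^+ 2 / r ^+ 2).
  by field; rewrite gt_eqF.
have x6 : 0 <= x ^+ 6 by exact: x6_ge0.
have x61 : x ^+ 6 <= 1.
  by rewrite -[x ^+ 6]ger0_norm // normrX exprn_ile1 // ltW.
have x21 : x ^+ 2 <= 1 by rewrite -real_normK ?num_real // exprn_ile1 // ltW.
have q0 : 0 <= q by case: h.
have yr : y ^+ 2 / r ^+ 2 <= 1.
  by rewrite ler_pdivrMr ?exprn_gt0 // mul1r r2; lra.
have mM : m <= 2 * M by rewrite /m mulrC ler_wpM2r ?(ltW M0) //; lra.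
have h4 : 3 * x ^+ 2 * m <= 3 * (2 * M).
  have : 3 * x ^+ 2 * m <= 3 * m by rewrite ler_wpM2r ?(ltW m0) //; lra.
  lra.
have h5 : 3 * x ^+ 2 * m * (y ^+ 2 / r ^+ 2) <= 3 * x ^+ 2 * m.
  rewrite ler_piMr //; apply: mulr_ge0 (ltW m0).
  by have := sqr_ge0 x; lra.
lra.
Qed.

(** The unbounded part of the [y]-derivative of [y * slope] is collected into a multiple of
    [rho^2 - y^2], whose sign is favourable. *)
Lemma dgenY_y M k x y q : off_ray x y q ->
  dgenY M k x y q 0 1 0 = 1 + k * (K (lev M x y q)
      * (3 * x ^+ 2 * (rho x y q ^+ 2 - y ^+ 2) / rho x y q ^+ 3
         - 6 * x ^+ 5 / (1 + x ^+ 6))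
    + K' (lev M x y q) * (M * (1 + x ^+ 6) * y ^+ 2 / rho x y q * slope x y q)).
Proof.
move=> h; have [r0 s0 _ _] := off_rayP h.
have x60 := x6_gt0 x.
rewrite /dgenY /dslope /dlev /dgap /drho /slope.
move: (K _) (K' _) => kk kk'; rewrite /gap.
move: (rho x y q) r0 => r r0.
field.
by rewrite !gt_eqF.
Qed.

(* By gen_closed the first quantity is both the y-derivative of genY and the
   x-derivative of genX; the two others bound genY / y (see genY_fact). *)
Definition admissible M k := forall x y q, off_ray x y q ->
  [/\ 0 < dgenY M k x y q 0 1 0, 0 < 1 + k * (K (lev M x y q) * slope x y q)
    & 1 + k * (K (lev M x y q) * slope x y q) <= 2 + 3 * x ^+ 2 / rho x y q].

Lemma exists_admissible M : 0 < M -> exists2 k, 0 < k & admissible M k.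
Proof.
move=> M0; have [C C0 hC] := @K_bounded R.
(* The negative contributions are at most [6 C] from the [K] term and [C (18 + 6 M)] from the [K']
   term. With [k B = 1/2] the derivative stays at least [1/2]. *)
pose B := C * (24 + 6 * M).
have B0 : 0 < B by rewrite mulr_gt0 // addr_gt0 // mulr_gt0.
exists (2 * B)^-1 => [|x y q h]; first by rewrite invr_gt0 mulr_gt0.
have k0 : 0 < (2 * B)^-1 by rewrite invr_gt0 mulr_gt0.
have kB : (2 * B)^-1 * B = 1 / 2 by field; rewrite gt_eqF.
set k := (2 * B)^-1 in k0 kB *.
have l0 := lev_gt0 M0 h; have [r0 s0 r2 rx] := off_rayP h.
have [KC K'C] := hC _ (ltW l0); have K0 := K_ge0 (ltW l0).
have [s1 s2] := slope_bounds x y q.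
have x20 := slope_main_ge0 x y q.
have CM : 0 < C * M by rewrite mulr_gt0.
have BE : B = 24 * C + 6 * (C * M) by rewrite /B; ring.
have k6 : k * (6 * C) <= 1 / 2 by rewrite -kB ler_wpM2l ?(ltW k0) // BE; lra.
have Ks1 : - (6 * C) <= K (lev M x y q) * slope x y q.
  apply: (@le_trans _ _ (K (lev M x y q) * -6)).
    by rewrite mulrN lerN2 mulrC ler_wpM2l.
  by rewrite ler_wpM2l.
have Ks2 : K (lev M x y q) * slope x y q <= C * (3 * x ^+ 2 / rho x y q) + 6 * C.
  apply: (@le_trans _ _ (K (lev M x y q) * (3 * x ^+ 2 / rho x y q + 6))).
    by rewrite ler_wpM2l // (le_trans (ler_norm _) s2).
  apply: (@le_trans _ _ (C * (3 * x ^+ 2 / rho x y q + 6))).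
    by rewrite ler_wpM2r // addr_ge0.
  by rewrite mulrDr; lra.
have kKs1 : - (1 / 2) <= k * (K (lev M x y q) * slope x y q).
  have := ler_wpM2l (ltW k0) Ks1; rewrite mulrN; lra.
split; [|lra|].
- rewrite dgenY_y //.
  suff hB : - B <= K (lev M x y q) *
      (3 * x ^+ 2 * (rho x y q ^+ 2 - y ^+ 2) / rho x y q ^+ 3
       - 6 * x ^+ 5 / (1 + x ^+ 6))
      + K' (lev M x y q) * (M * (1 + x ^+ 6) * y ^+ 2 / rho x y q * slope x y q).
    by have := ler_wpM2l (ltW k0) hB; rewrite mulrN kB; lra.
  have q0 : 0 <= q by case: h.
  have h1 : 0 <= 3 * x ^+ 2 * (rho x y q ^+ 2 - y ^+ 2) / rho x y q ^+ 3.
    have e : 0 <= rho x y q ^+ 2 - y ^+ 2 by rewrite r2; have := x6_ge0 x; lra.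
    apply: divr_ge0; last by rewrite exprn_ge0 // ltW.
    by apply: mulr_ge0 e; have := sqr_ge0 x; lra.
  have := mu_bound x; rewrite ler_norml => /andP[_ mu6].
  have h2 : - (6 * C) <= K (lev M x y q) *
      (3 * x ^+ 2 * (rho x y q ^+ 2 - y ^+ 2) / rho x y q ^+ 3
       - 6 * x ^+ 5 / (1 + x ^+ 6)).
    apply: (@le_trans _ _ (K (lev M x y q) * -6)).
      by rewrite mulrN lerN2 mulrC ler_wpM2l.
    by rewrite ler_wpM2l //; lra.
  have h3 : - (C * (18 + 6 * M)) <= K' (lev M x y q) *
      (M * (1 + x ^+ 6) * y ^+ 2 / rho x y q * slope x y q).
    (* Above level 1 the factor [K'] vanishes, so the bound on its coefficient is required only
       where [lev <= 1]. *)
    case: (leP (lev M x y q) 1) => l1; last first.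
      rewrite (K'_ge1 (ltW l1)) mul0r oppr_le0.
      by apply: mulr_ge0 (ltW C0) _; lra.
    have := slope_lev_bound M0 h l1; set Z := _ * slope x y q => hZ.
    have : `|K' (lev M x y q) * Z| <= C * (18 + 6 * M).
      by rewrite normrM ler_pM.
    by rewrite ler_norml => /andP[].
  rewrite BE; move: h2 h3; rewrite mulrDr; lra.
- have kC : k * C <= 1 by lra.
  have := ler_wpM2l (ltW k0) Ks2; rewrite mulrDr mulrA.
  have := ler_wpM2r x20 kC; rewrite mul1r; lra.
Qed.

End GeneratingFunction.

(** * The generating data evaluated on coordinate functions: derivatives and smoothness *)

Section Composition.
Context {R : realType} {d : nat}.
Implicit Types (p v : 'rV[R]_d).
Variables (fx fy fq : 'rV[R]_d -> R).

Section Derivs.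
Variables (p : 'rV[R]_d) (dx dy dq : 'rV[R]_d -> R).
Hypothesis hx : has_derivs fx p dx.
Hypothesis hy : has_derivs fy p dy.
Hypothesis hq : has_derivs fq p dq.
Hypothesis hp : off_ray (fx p) (fy p) (fq p).
Variables (M k : R).
Hypothesis M0 : 0 < M.

Let cst (c : R) := has_derivs_cst c p.

Let X n f df (hf : has_derivs f p df) :
  has_derivs (fun a => f a ^+ n) p (fun v => n%:R * f p ^+ n.-1 * df v).
Proof.
elim: n => [|n IH].
  under [X in has_derivs X]eq_fun do rewrite expr0.
  by apply: has_derivs_eq (cst 1) _ => v; rewrite !mul0r.
under [X in has_derivs X]eq_fun do rewrite exprS.
apply: has_derivs_eq (has_derivsM hf IH) _ => v /=.
case: n {IH} => [|n]; first by rewrite !expr0; ring.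
by rewrite /= -[n.+2%:R]natr1 exprS; ring.
Qed.

Let r := rho (fx p) (fy p) (fq p).
Let s := gap (fx p) (fy p) (fq p).

Let hrho : has_derivs (fun a => rho (fx a) (fy a) (fq a)) p
  (fun v => drho (fx p) (fy p) (fq p) (dx v) (dy v) (dq v)).
Proof.
have [r0 _ r2 _] := off_rayP hp.
have g0 : 0 < fx p ^+ 6 + fy p ^+ 2 + fq p by rewrite -r2 exprn_gt0.
apply: has_derivs_eq (has_derivs_comp (has_derivsD (has_derivsD (X 6 hx) (X 2 hy)) hq)
  (is_derive1_sqrt g0)) _ => v /=.
by rewrite /drho -/(rho _ _ _) expr1 mulrC.
Qed.

Let hgap : has_derivs (fun a => gap (fx a) (fy a) (fq a)) p
  (fun v => dgap (fx p) (fy p) (fq p) (dx v) (dy v) (dq v)).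
Proof. exact: has_derivs_eq (has_derivsB hrho (X 3 hx)) _. Qed.

Let hlev : has_derivs (fun a => lev M (fx a) (fy a) (fq a)) p
  (fun v => dlev M (fx p) (fy p) (fq p) (dx v) (dy v) (dq v)).
Proof.
apply: has_derivs_eq (has_derivsM (has_derivsM (cst M)
  (has_derivsD (cst 1) (X 6 hx))) hgap) _ => v /=.
by rewrite /dlev; ring.
Qed.

Let hK : has_derivs (fun a => K (lev M (fx a) (fy a) (fq a))) p
  (fun v => K' (lev M (fx p) (fy p) (fq p))
     * dlev M (fx p) (fy p) (fq p) (dx v) (dy v) (dq v)).
Proof. by apply: has_derivs_comp hlev _; apply/is_derive_K/ltW/lev_gt0. Qed.

Let hrs : has_derivs (fun a => (rho (fx a) (fy a) (fq a) * gap (fx a) (fy a) (fq a))^-1) p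
  (fun v => - drs (fx p) (fy p) (fq p) (dx v) (dy v) (dq v) / (r * s) ^+ 2).
Proof.
have [r0 s0 _ _] := off_rayP hp.
have n0 : r * s != 0 by rewrite mulf_neq0 // gt_eqF.
apply: has_derivs_eq (has_derivsV (has_derivsM hrho hgap) n0) _ => v /=.
by rewrite /drs -/r -/s; field; rewrite !gt_eqF.
Qed.

Lemma has_derivs_genY : has_derivs (fun a => genY M k (fx a) (fy a) (fq a)) p
  (fun v => dgenY M k (fx p) (fy p) (fq p) (dx v) (dy v) (dq v)).
Proof.
have [r0 s0 _ _] := off_rayP hp; have x60 := x6_gt0 (fx p).
have rn : rho (fx p) (fy p) (fq p) != 0 by rewrite gt_eqF.
have xn : 1 + fx p ^+ 6 != 0 by rewrite gt_eqF.
have h1 := has_derivsM (has_derivsM (cst 3) (X 2 hx)) (has_derivsV hrho rn).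
have h2 := has_derivsM (has_derivsM (cst 6) (X 5 hx))
  (has_derivsV (has_derivsD (cst 1) (X 6 hx)) xn).
apply: has_derivs_eq (has_derivsD hy (has_derivsM (cst k)
  (has_derivsM (has_derivsM hy hK) (has_derivsB h1 h2)))) _ => v /=.
rewrite /dgenY /dslope /slope.
move: (K _) (K' _) (dlev _ _ _ _ _ _ _) (drho _ _ _ _ _ _) (rho _ _ _) rn => *.
by field; apply/andP.
Qed.

Lemma has_derivs_genX : has_derivs (fun a => genX M k (fx a) (fy a) (fq a)) p
  (fun v => dgenX M k (fx p) (fy p) (fq p) (dx v) (dy v) (dq v)).
Proof.
have hG := has_derivs_comp hlev (is_derive_G (lev_gt0 M0 hp)).
apply: has_derivs_eq (has_derivsD hx (has_derivsM (cst k)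
  (has_derivsB hG (has_derivsM (has_derivsM hK (X 2 hy)) hrs)))) _ => v /=.
by rewrite /dgenX -/r -/s expr1; ring.
Qed.

Lemma has_derivs_genA : has_derivs (fun a => genA M k (fx a) (fy a) (fq a)) p
  (fun v => dgenA M k (fx p) (fy p) (fq p) (dx v) (dy v) (dq v)).
Proof.
apply: has_derivs_eq (has_derivsM (cst k) (has_derivsM (has_derivsM hK hy) hrs)) _ => v /=.
by rewrite /dgenA -/r -/s; ring.
Qed.

End Derivs.

Section Smooth.
Variables (U : set 'rV[R]_d) (M k : R).
Hypothesis (oU : open U) (M0 : 0 < M).
Hypothesis (sx : smooth U fx) (sy : smooth U fy) (sq : smooth U fq).
Hypothesis Uray : forall p, U p -> off_ray (fx p) (fy p) (fq p).

Let srho : smooth U (fun a => rho (fx a) (fy a) (fq a)).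
Proof.
move=> m; apply: Cks_sqrt => //.
  by move=> p /Uray/off_rayP[r0 _ <- _]; rewrite exprn_gt0.
by apply: CksD => //; apply: CksD => //; exact: CksX.
Qed.

Let sgap : smooth U (fun a => gap (fx a) (fy a) (fq a)).
Proof. by move=> m; apply: CksB => //; exact: CksX. Qed.

Let sx6 : smooth U (fun a => 1 + fx a ^+ 6).
Proof. by move=> m; apply: CksD => //; [exact: Cks_cst | exact: CksX]. Qed.

Let slev : smooth U (fun a => lev M (fx a) (fy a) (fq a)).
Proof.
by move=> m; apply: CksM => //; apply: CksM => //; exact: Cks_cst.
Qed.

Let lev0 p : U p -> 0 < lev M (fx p) (fy p) (fq p).
Proof. by move=> /Uray; exact: lev_gt0. Qed.

Let srs p : U p -> rho (fx p) (fy p) (fq p) * gap (fx p) (fy p) (fq p) != 0.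
Proof. by move=> /Uray/off_rayP[r0 s0 _ _]; rewrite mulf_neq0 // gt_eqF. Qed.

Lemma smooth_genY : smooth U (fun a => genY M k (fx a) (fy a) (fq a)).
Proof.
move=> m; apply: CksD => //; apply: CksM => //; first exact: Cks_cst.
apply: CksM => //.
  by apply: CksM => //; exact: Cks_K.
apply: CksB => //; apply: Cks_div => //.
- by move=> p /Uray/off_rayP[r0 _ _ _]; rewrite gt_eqF.
- by apply: CksM => //; [exact: Cks_cst | exact: CksX].
- by move=> p _; rewrite gt_eqF // x6_gt0.
- by apply: CksM => //; [exact: Cks_cst | exact: CksX].
Qed.

Lemma smooth_genX : smooth U (fun a => genX M k (fx a) (fy a) (fq a)).
Proof.
move=> m; apply: CksD => //; apply: CksM => //; first exact: Cks_cst.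
apply: CksB => //; first exact: Cks_G.
apply: Cks_div => //; last exact: CksM.
by apply: CksM => //; [exact: Cks_K | exact: CksX].
Qed.

Lemma smooth_genA : smooth U (fun a => genA M k (fx a) (fy a) (fq a)).
Proof.
move=> m; apply: CksM => //; first exact: Cks_cst.
apply: Cks_div => //; last exact: CksM.
by apply: CksM => //; exact: Cks_K.
Qed.

End Smooth.

End Composition.

(** * Coordinates on R^(2n) *)

Section Coordinates.
Context {R : realType} {n : nat}.
Notation V := 'rV[R]_(2 * n.+1).
Implicit Types (p q u v : V) (i : 'I_n.+1) (j : 'I_(2 * n.+1)).

Definition xl : 'I_(2 * n.+1) := xidx (ord_max : 'I_n.+1).
Definition yl : 'I_(2 * n.+1) := yidx (ord_max : 'I_n.+1).

Lemma pidx_subproof j : (j./2 < n.+1)%N.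
Proof. by have := ltn_ord j; lia. Qed.

Definition pidx j : 'I_n.+1 := Ordinal (pidx_subproof j).

Lemma pidx_xidx i : pidx (xidx i) = i.
Proof. by apply: val_inj => /=; lia. Qed.

Lemma pidx_yidx i : pidx (yidx i) = i.
Proof. by apply: val_inj => /=; lia. Qed.

Lemma odd_xidx i : odd (xidx i) = false.
Proof. by rewrite /= mul2n odd_double. Qed.

Lemma odd_yidx i : odd (yidx i) = true.
Proof. by rewrite /= mul2n odd_double. Qed.

Lemma idx_cases j : j = if odd j then yidx (pidx j) else xidx (pidx j).
Proof. by apply: val_inj; case: ifP => /= oj; lia. Qed.

Lemma xidx_neq_yl i : xidx i == yl = false.
Proof. by apply/negbTE/eqP => /(congr1 val) /=; lia. Qed.

Lemma yidx_neq_xl i : yidx i == xl = false.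
Proof. by apply/negbTE/eqP => /(congr1 val) /=; lia. Qed.

Lemma xidx_eq_xl i : (xidx i == xl) = (i == ord_max).
Proof.
apply/eqP/eqP => [|-> //].
by move/(congr1 pidx); rewrite !pidx_xidx.
Qed.

Lemma yidx_eq_yl i : (yidx i == yl) = (i == ord_max).
Proof.
apply/eqP/eqP => [|-> //].
by move/(congr1 pidx); rewrite !pidx_yidx.
Qed.

Lemma row_pairP p q :
  (forall i, p 0 (xidx i) = q 0 (xidx i) /\ p 0 (yidx i) = q 0 (yidx i)) -> p = q.
Proof.
move=> h; apply/rowP => j; rewrite (idx_cases j).
by have [h1 h2] := h (pidx j); case: ifP.
Qed.

Definition sqz p : R :=
  \sum_(i < n.+1 | i != ord_max) (p 0 (xidx i) ^+ 2 + p 0 (yidx i) ^+ 2).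

Definition dsqz p v : R := \sum_(i < n.+1 | i != ord_max)
  2 * (p 0 (xidx i) * v 0 (xidx i) + p 0 (yidx i) * v 0 (yidx i)).

Lemma sqz_ge0 p : 0 <= sqz p.
Proof. by apply: sumr_ge0 => i _; rewrite addr_ge0 // sqr_ge0. Qed.

Lemma sqz_eq0 p : sqz p = 0 ->
  forall i, i != ord_max -> p 0 (xidx i) = 0 /\ p 0 (yidx i) = 0.
Proof.
move=> h i ni.
have h0 k : k != ord_max -> 0 <= p 0 (xidx k) ^+ 2 + p 0 (yidx k) ^+ 2.
  by move=> _; rewrite addr_ge0 // sqr_ge0.
have := psumr_eq0P h0 h ni.
move/eqP; rewrite paddr_eq0 ?sqr_ge0 // !sqrf_eq0.
by move=> /andP[/eqP -> /eqP ->].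
Qed.

Lemma has_derivs_sqz p : has_derivs sqz p (dsqz p).
Proof.
apply: has_derivs_eq (has_derivs_sum _ _) _ => [i _|v].
  exact: has_derivsD (has_derivsM (has_derivs_coord _ p) (has_derivs_coord _ p))
    (has_derivsM (has_derivs_coord _ p) (has_derivs_coord _ p)).
by apply: eq_bigr => i _ /=; ring.
Qed.

Lemma smooth_sqz (U : set V) : open U -> smooth U sqz.
Proof.
move=> oU k; apply: Cks_sum => // i _.
by apply: CksD => //; apply: CksX => //; exact: Cks_coord.
Qed.

Lemma upd_xl_y p a : (upd p xl a) 0 yl = p 0 yl.
Proof. by rewrite mxE yidx_neq_xl. Qed.

Lemma upd_yl_x p a : (upd p yl a) 0 xl = p 0 xl.
Proof. by rewrite mxE xidx_neq_yl. Qed.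

Lemma sqz_upd_xl p a : sqz (upd p xl a) = sqz p.
Proof.
apply: eq_bigr => i ni; rewrite !mxE yidx_neq_xl.
by rewrite xidx_eq_xl (negbTE ni).
Qed.

Lemma sqz_upd_yl p a : sqz (upd p yl a) = sqz p.
Proof.
apply: eq_bigr => i ni; rewrite !mxE xidx_neq_yl.
by rewrite yidx_eq_yl (negbTE ni).
Qed.

Lemma dsqz_delta_xl p : dsqz p (delta_mx 0 xl) = 0.
Proof.
apply: big1 => i ni; rewrite !mxE /= yidx_neq_xl.
by rewrite xidx_eq_xl (negbTE ni) !mulr0 addr0 mulr0.
Qed.

Lemma dsqz_delta_yl p : dsqz p (delta_mx 0 yl) = 0.
Proof.
apply: big1 => i ni; rewrite !mxE /= xidx_neq_yl.
by rewrite yidx_eq_yl (negbTE ni) !mulr0 addr0 mulr0.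
Qed.

(** Multiplication by [i] in every coordinate plane; [zrot t] is then multiplication by [e^{i t}] in
    all planes but the last. *)
Definition jrot p : V :=
  \row_j (if odd j then p 0 (xidx (pidx j)) else - p 0 (yidx (pidx j))).

Definition zrot (t : R) p : V :=
  \row_j (if pidx j == ord_max then p 0 j else cos t * p 0 j + sin t * jrot p 0 j).

Lemma jrot_x p i : jrot p 0 (xidx i) = - p 0 (yidx i).
Proof. by rewrite mxE odd_xidx pidx_xidx. Qed.

Lemma jrot_y p i : jrot p 0 (yidx i) = p 0 (xidx i).
Proof. by rewrite mxE odd_yidx pidx_yidx. Qed.

Lemma zrot_x t p i : zrot t p 0 (xidx i) = if i == ord_max then p 0 (xidx i)
  else cos t * p 0 (xidx i) - sin t * p 0 (yidx i).
Proof. by rewrite mxE pidx_xidx jrot_x mulrN. Qed.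

Lemma zrot_y t p i : zrot t p 0 (yidx i) = if i == ord_max then p 0 (yidx i)
  else cos t * p 0 (yidx i) + sin t * p 0 (xidx i).
Proof. by rewrite mxE pidx_yidx jrot_y. Qed.

Lemma zrot_xl t p : zrot t p 0 xl = p 0 xl.
Proof. by rewrite zrot_x eqxx. Qed.

Lemma zrot_yl t p : zrot t p 0 yl = p 0 yl.
Proof. by rewrite zrot_y eqxx. Qed.

Lemma sqz_zrot t p : sqz (zrot t p) = sqz p.
Proof.
apply: eq_bigr => i ni; rewrite zrot_x zrot_y (negbTE ni).
transitivity ((cos t ^+ 2 + sin t ^+ 2) * (p 0 (xidx i) ^+ 2 + p 0 (yidx i) ^+ 2)).
  ring.
by rewrite cos2Dsin2 mul1r.
Qed.

Lemma zrot0 p : zrot 0 p = p.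
Proof.
apply/rowP => j; rewrite mxE cos0 sin0 mul1r mul0r addr0.
by case: ifP.
Qed.

Lemma zrotNK t p : zrot (- t) (zrot t p) = p.
Proof.
apply: row_pairP => i; rewrite !(zrot_x, zrot_y) cosN sinN.
case: (i == ord_max); split => //.
- transitivity ((cos t ^+ 2 + sin t ^+ 2) * p 0 (xidx i)); first ring.
  by rewrite cos2Dsin2 mul1r.
- transitivity ((cos t ^+ 2 + sin t ^+ 2) * p 0 (yidx i)); first ring.
  by rewrite cos2Dsin2 mul1r.
Qed.

Lemma zrot_upd_xl t p a : zrot t (upd p xl a) = upd (zrot t p) xl a.
Proof.
apply: row_pairP => i; split.
  rewrite [RHS]mxE !zrot_x !mxE yidx_neq_xl xidx_eq_xl.
  by case: (i == ord_max).
rewrite [RHS]mxE yidx_neq_xl !zrot_y !mxE yidx_neq_xl xidx_eq_xl.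
by case: (i == ord_max).
Qed.

Definition ray_coords p := off_ray (p 0 xl) (p 0 yl) (sqz p).

(** Since [|z|^2] vanishes only at [z = 0], membership in [M1] depends on [p] through
    [(x, y, |z|^2)] alone, the arguments of the generating data. *)
Lemma M1E p : M1 R n p <-> ray_coords p.
Proof.
split=> [hM|[_ h] [s s0 e]].
  split; first exact: sqz_ge0.
  have [h|h] := ltP 0 (p 0 yl ^+ 2 + sqz p); [by left | right].
  have q0 := sqz_ge0 p; have y0 := sqr_ge0 (p 0 yl).
  rewrite ltNge; apply/negP => x0; apply: hM; exists (p 0 xl) => //.
  have qe : sqz p = 0 by lra.
  have ye : p 0 yl = 0 by apply/eqP; rewrite -sqrf_eq0; apply/eqP; lra.
  apply: row_pairP => i; rewrite !mxE yidx_neq_xl xidx_eq_xl.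
  have [->|ni] := eqVneq i ord_max; first by split.
  by have [] := sqz_eq0 qe ni.
have xE : p 0 xl = s by rewrite e mxE eqxx.
have yE : p 0 yl = 0 by rewrite e mxE yidx_neq_xl.
have qE : sqz p = 0.
  apply: big1 => i ni; rewrite e !mxE yidx_neq_xl xidx_eq_xl (negbTE ni).
  by rewrite expr0n addr0.
by case: h; rewrite ?xE ?yE ?qE ?expr0n ?addr0 ?ltxx // ltNge s0.
Qed.

Lemma open_M1 : open (M1 R n).
Proof.
have -> : M1 R n = (fun p : V => p 0 yl ^+ 2 + sqz p) @^-1` [set x | 0 < x]
    `|` (fun p : V => p 0 xl) @^-1` [set x | x < 0].
  apply/seteqP; split => p; first by move=> /M1E[_].
  by move=> h; apply/M1E; split => //; exact: sqz_ge0.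
have sm : smooth setT (fun p : V => p 0 yl ^+ 2 + sqz p).
  move=> k; apply: CksD; first exact: openT.
    by apply: CksX; [exact: openT | apply: Cks_coord; exact: openT].
  by apply: smooth_sqz; exact: openT.
apply: openU; apply: open_comp.
- by move=> p _; exact: (sm 0%N p).
- exact: open_gt.
- by move=> p _; exact: coord_continuous.
- exact: open_lt.
Qed.

End Coordinates.

(** * The two triangular maps are bijective *)

Section FiberBijections.
Context {R : realType} {n : nat}.
Notation V := 'rV[R]_(2 * n.+1).
Implicit Types (p q u v : V).
Local Notation xl := (@xl n).
Local Notation yl := (@yl n).
Local Notation M1 := (M1 R n).

Variables (M k : R).
Hypothesis (M1_le : 1 <= M) (k_gt0 : 0 < k).
Hypothesis hk : admissible M k.

Definition coordY p := genY M k (p 0 xl) (p 0 yl) (sqz p).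
Definition coordX p := genX M k (p 0 xl) (p 0 yl) (sqz p).
Definition coordA p := genA M k (p 0 xl) (p 0 yl) (sqz p).

Let M_gt0 : 0 < M. Proof. exact: lt_le_trans M1_le. Qed.
Let M_neq0 : M != 0. Proof. by rewrite gt_eqF. Qed.

Section AtPoint.
Variables (p : V) (hp : M1 p).
Let rp : off_ray (p 0 xl) (p 0 yl) (sqz p). Proof. exact/M1E. Qed.
Let cx := has_derivs_coord xl p.
Let cy := has_derivs_coord yl p.

Lemma has_derivs_coordY : has_derivs coordY p (fun v =>
  dgenY M k (p 0 xl) (p 0 yl) (sqz p) (v 0 xl) (v 0 yl) (dsqz p v)).
Proof. exact (has_derivs_genY cx cy (has_derivs_sqz p) rp k M_gt0). Qed.

Lemma has_derivs_coordX : has_derivs coordX p (fun v =>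
  dgenX M k (p 0 xl) (p 0 yl) (sqz p) (v 0 xl) (v 0 yl) (dsqz p v)).
Proof. exact (has_derivs_genX cx cy (has_derivs_sqz p) rp k M_gt0). Qed.

Lemma has_derivs_coordA : has_derivs coordA p (fun v =>
  dgenA M k (p 0 xl) (p 0 yl) (sqz p) (v 0 xl) (v 0 yl) (dsqz p v)).
Proof. exact (has_derivs_genA cx cy (has_derivs_sqz p) rp k M_gt0). Qed.

Lemma coordY_deriv_gt0 : 0 < 'D_(delta_mx 0 yl) coordY p.
Proof.
have [_ ->] := has_derivs_coordY.
rewrite !mxE /= eqxx xidx_neq_yl dsqz_delta_yl /=.
by have [] := hk rp.
Qed.

Lemma coordX_deriv_gt0 : 0 < 'D_(delta_mx 0 xl) coordX p.
Proof.
have [_ ->] := has_derivs_coordX.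
rewrite !mxE /= eqxx yidx_neq_xl dsqz_delta_xl /= dgenX_x //.
by have [] := hk rp.
Qed.

End AtPoint.

Let oM1 := @open_M1 R n.
Let sx : smooth M1 (fun p => p 0 xl). Proof. by move=> m; exact: Cks_coord. Qed.
Let sy : smooth M1 (fun p => p 0 yl). Proof. by move=> m; exact: Cks_coord. Qed.
Let sq : smooth M1 sqz. Proof. exact: smooth_sqz. Qed.
Let ray p : M1 p -> off_ray (p 0 xl) (p 0 yl) (sqz p). Proof. by move/M1E. Qed.

Lemma smooth_coordY : smooth M1 coordY.
Proof. exact (smooth_genY k oM1 M_gt0 sx sy sq ray). Qed.

Lemma smooth_coordX : smooth M1 coordX.
Proof. exact (smooth_genX k oM1 M_gt0 sx sy sq ray). Qed.

Lemma smooth_coordA : smooth M1 coordA.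
Proof. exact (smooth_genA k oM1 M_gt0 sx sy sq ray). Qed.

Lemma M1_upd_yl p s : M1 (upd p yl s) <-> off_ray (p 0 xl) s (sqz p).
Proof.
by rewrite M1E /ray_coords upd_yl_x updj sqz_upd_yl.
Qed.

Lemma M1_upd_xl p s : M1 (upd p xl s) <-> off_ray s (p 0 yl) (sqz p).
Proof.
by rewrite M1E /ray_coords upd_xl_y updj sqz_upd_xl.
Qed.

Lemma coordY_upd p s : coordY (upd p yl s) = genY M k (p 0 xl) s (sqz p).
Proof. by rewrite /coordY upd_yl_x updj sqz_upd_yl. Qed.

Lemma coordX_upd p s : coordX (upd p xl s) = genX M k s (p 0 yl) (sqz p).
Proof. by rewrite /coordX upd_xl_y updj sqz_upd_xl. Qed.

Lemma genY_fact (x y q : R) : genY M k x y q = y * (1 + k * (K (lev M x y q) * slope x y q)).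
Proof. by rewrite /genY; ring. Qed.

(** Admissibility makes the factor multiplying [y] positive. Where [x >= 0] and [q = 0], the ray
    removes [y = 0] from the fibre, and each of the two half-lines is kept in place. *)
Lemma genY_sg (x y q : R) : off_ray x y q -> Num.sg (genY M k x y q) = Num.sg y.
Proof.
move=> /hk[_ h _].
by rewrite genY_fact sgrM [X in _ * X]gtr0_sg // mulr1.
Qed.

Lemma genY_level1 (x y q : R) : 1 <= lev M x y q -> genY M k x y q = y.
Proof. by move=> h; rewrite genY_fact (K_ge1 h) mul0r mulr0 addr0 mulr1. Qed.

Lemma genX_level1 (x y q : R) : 1 <= lev M x y q -> genX M k x y q = x.
Proof.
by move=> h; rewrite /genX (K_ge1 h) (G_ge1 h) !mul0r subr0 mulr0 addr0.
Qed.

Lemma genA_level1 (x y q : R) : 1 <= lev M x y q -> genA M k x y q = 0.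
Proof. by move=> h; rewrite /genA (K_ge1 h) !mul0r mulr0. Qed.

Lemma rhoN (x y q : R) : rho x (- y) q = rho x y q.
Proof. by rewrite /rho sqrrN. Qed.

Lemma genY_odd (x y q : R) : genY M k x (- y) q = - genY M k x y q.
Proof.
by rewrite !genY_fact /lev /slope /gap rhoN mulNr.
Qed.

Lemma fiber_increasing_yl p (a b : R) : a < b ->
  (forall s, a <= s <= b -> off_ray (p 0 xl) s (sqz p)) ->
  coordY (upd p yl a) < coordY (upd p yl b).
Proof.
move=> ab h; rewrite (upd_line p yl a) (upd_line p yl b).
apply: line_increasing => // s hs; rewrite -upd_line.
  by have /has_derivs_coordY[] : M1 (upd p yl s) by exact/M1_upd_yl/h.
exact/coordY_deriv_gt0/M1_upd_yl/h.
Qed.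

Lemma fiber_increasing_xl p (a b : R) : a < b ->
  (forall s, a <= s <= b -> off_ray s (p 0 yl) (sqz p)) ->
  coordX (upd p xl a) < coordX (upd p xl b).
Proof.
move=> ab h; rewrite (upd_line p xl a) (upd_line p xl b).
apply: line_increasing => // s hs; rewrite -upd_line.
  by have /has_derivs_coordX[] : M1 (upd p xl s) by exact/M1_upd_xl/h.
exact/coordX_deriv_gt0/M1_upd_xl/h.
Qed.

(** Monotonicity alone is not enough, as a fibre may be a line without 0. Equal values have
    arguments of equal sign, so the segment between them avoids the ray. *)
Lemma coordY_inj p p' : M1 p -> M1 p' -> upd p yl (coordY p) = upd p' yl (coordY p') -> p = p'.
Proof.
move=> hp hp' e.
have pE : p' = upd p yl (p' 0 yl).
  by rewrite -[LHS](upd_id p' yl) -[LHS](upd_upd _ _ (coordY p')) -e upd_upd.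
have Fe : coordY p = coordY p' by move/rowP: e => /(_ yl); rewrite !updj.
have key (a b : R) : a < b -> off_ray (p 0 xl) a (sqz p) -> off_ray (p 0 xl) b (sqz p) ->
    coordY (upd p yl a) <> coordY (upd p yl b).
  move=> ab ha hb Fab.
  have sg : Num.sg a = Num.sg b.
    by rewrite -(genY_sg ha) -(genY_sg hb) -!coordY_upd Fab.
  suff : coordY (upd p yl a) < coordY (upd p yl b) by rewrite Fab ltxx.
  apply: fiber_increasing_yl => // s /andP[h1 h2].
  have [q0 h] := ha; split => //.
  case: h => [h|]; last by right.
  have [q00|qp] := eqVneq (sqz p) 0; last first.
    left; have := sqr_ge0 s; have : 0 < sqz p by rewrite lt_def qp.
    lra.
  left; rewrite q00 addr0 exprn_even_gt0 //=.
  have a0 : a != 0.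
    by move: h; rewrite q00 addr0 exprn_even_gt0.
  apply/eqP => s0; move: sg h1 h2; rewrite s0 => sg h1 h2.
  have an : a < 0 by rewrite lt_neqAle a0.
  by move: sg; rewrite (ltr0_sg an) => /esym/eqP; rewrite sgr_cp0 ltNge h2.
have rp := ray hp.
have rp' : off_ray (p 0 xl) (p' 0 yl) (sqz p) by apply/M1_upd_yl; rewrite -pE.
have pid : p = upd p yl (p 0 yl) by rewrite upd_id.
have [h|h|h] := ltgtP (p 0 yl) (p' 0 yl).
- by have := key _ _ h rp rp'; rewrite -pid -pE.
- by have := key _ _ h rp' rp; rewrite -pid -pE => /(_ (esym Fe)).
- by rewrite pE -h upd_id.
Qed.

(** Here every fibre is convex, either a full line or the half-line [x < 0], so monotonicity applies
    directly. *)
Lemma coordX_inj p p' : M1 p -> M1 p' -> upd p xl (coordX p) = upd p' xl (coordX p') -> p = p'.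
Proof.
move=> hp hp' e.
have pE : p' = upd p xl (p' 0 xl).
  by rewrite -[LHS](upd_id p' xl) -[LHS](upd_upd _ _ (coordX p')) -e upd_upd.
have Fe : coordX p = coordX p' by move/rowP: e => /(_ xl); rewrite !updj.
have key (a b : R) : a < b -> off_ray b (p 0 yl) (sqz p) ->
    coordX (upd p xl a) <> coordX (upd p xl b).
  move=> ab [q0 hb] Fab.
  suff : coordX (upd p xl a) < coordX (upd p xl b) by rewrite Fab ltxx.
  apply: fiber_increasing_xl => // s /andP[h1 h2]; split => //.
  by case: hb => [|b0]; [left | right; exact: le_lt_trans b0].
have rp := ray hp.
have rp' : off_ray (p' 0 xl) (p 0 yl) (sqz p) by apply/M1_upd_xl; rewrite -pE.
have pid : p = upd p xl (p 0 xl) by rewrite upd_id.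
have [h|h|h] := ltgtP (p 0 xl) (p' 0 xl).
- by have := key _ _ h rp'; rewrite -pid -pE.
- by have := key _ _ h rp; rewrite -pid -pE => /(_ (esym Fe)).
- by rewrite pE -h upd_id.
Qed.

Lemma fiber_IVT_yl p (a b y : R) : a <= b ->
  (forall s, a <= s <= b -> off_ray (p 0 xl) s (sqz p)) ->
  genY M k (p 0 xl) a (sqz p) <= y <= genY M k (p 0 xl) b (sqz p) ->
  exists2 s, a <= s <= b & genY M k (p 0 xl) s (sqz p) = y.
Proof.
move=> ab h hy.
have [//|s hs|//|s hs e] := @line_IVT _ _ coordY (upd p yl 0) (delta_mx 0 yl) a b y.
- by rewrite -upd_line; have /has_derivs_coordY[] : M1 (upd p yl s) by exact/M1_upd_yl/h.
- by rewrite -!upd_line !coordY_upd.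
by exists s => //; rewrite -coordY_upd upd_line.
Qed.

Lemma fiber_IVT_xl p (a b x : R) : a <= b ->
  (forall s, a <= s <= b -> off_ray s (p 0 yl) (sqz p)) ->
  genX M k a (p 0 yl) (sqz p) <= x <= genX M k b (p 0 yl) (sqz p) ->
  exists2 s, a <= s <= b & genX M k s (p 0 yl) (sqz p) = x.
Proof.
move=> ab h hy.
have [//|s hs|//|s hs e] := @line_IVT _ _ coordX (upd p xl 0) (delta_mx 0 xl) a b x.
- by rewrite -upd_line; have /has_derivs_coordX[] : M1 (upd p xl s) by exact/M1_upd_xl/h.
- by rewrite -!upd_line !coordX_upd.
by exists s => //; rewrite -coordX_upd upd_line.
Qed.

(** On the positive half-line a small argument gives a value below the target and a large one, at
    level at least 1, is fixed by [genY]. Oddness handles negative targets, and 0 is fixed. *)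
Lemma genY_surj p (y : R) : off_ray (p 0 xl) y (sqz p) ->
  exists2 s, off_ray (p 0 xl) s (sqz p) & genY M k (p 0 xl) s (sqz p) = y.
Proof.
move=> hy; have q0 := sqz_ge0 p.
have pos (z : R) : 0 < z ->
    exists2 s, off_ray (p 0 xl) s (sqz p) & genY M k (p 0 xl) s (sqz p) = z.
  move=> z0.
  have ray_pos s : 0 < s -> off_ray (p 0 xl) s (sqz p).
    by move=> s0; split => //; left; rewrite ltr_pwDl // exprn_gt0.
  set x := p 0 xl in ray_pos *.
  (* As [rho >= |x^3|], this bounds [genY / s] uniformly in [s > 0]. At [x = 0] the quotient is 0 by
     convention, in agreement with the vanishing of [3 x^2 / rho] there. *)
  pose c := 2 + 3 * x ^+ 2 / `|x ^+ 3|.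
  have c2 : 2 <= c.
    by rewrite lerDl; apply: divr_ge0 => //; apply: mulr_ge0 => //; exact: sqr_ge0.
  have c0 : 0 < c by lra.
  have s1 : 0 < z / c by rewrite divr_gt0.
  have h1 : genY M k x (z / c) (sqz p) <= z.
    rewrite genY_fact; have [_ _ h] := hk (ray_pos _ s1).
    apply: (@le_trans _ _ (z / c * c)); last by rewrite divfK // gt_eqF.
    rewrite ler_wpM2l ?(ltW s1) //; apply: (le_trans h); rewrite lerD2l.
    have [->|x0] := eqVneq x 0; first by rewrite expr0n mulr0 !mul0r.
    have [r0 _ _ hr] := off_rayP (ray_pos _ s1).
    apply: ler_wpM2l; first by apply: mulr_ge0 => //; exact: sqr_ge0.
    by rewrite lef_pV2 // posrE normr_gt0 expf_neq0.
  (* From [rho >= s2] follows [gap >= 1], hence [lev >= 1] because [M >= 1]. *)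
  pose s2 := Num.max z (1 + `|x ^+ 3|).
  have s20 : 0 < s2 by rewrite lt_max z0.
  have h2 : z <= genY M k x s2 (sqz p).
    rewrite genY_level1; first by rewrite le_max lexx.
    have [r0 _ r2 _] := off_rayP (ray_pos _ s20).
    have sr : s2 <= rho x s2 (sqz p).
      rewrite -(@ler_pXn2r _ 2) // ?nnegrE ?(ltW s20) ?(ltW r0) // r2.
      by have := x6_ge0 x; lra.
    have : 1 + `|x ^+ 3| <= s2 by rewrite le_max lexx orbT.
    have := ler_norm (x ^+ 3) => a1 a2.
    have g1 : 1 <= gap x s2 (sqz p) by rewrite /gap; lra.
    have m1 : 1 <= M * (1 + x ^+ 6).
      by rewrite -[leLHS]mul1r ler_pM //; have := x6_ge0 x; lra.
    by rewrite -[leLHS]mul1r ler_pM.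
  have s12 : z / c <= s2.
    apply: (@le_trans _ _ z); last by rewrite le_max lexx.
    by rewrite ler_pdivrMr // ler_peMr ?(ltW z0) //; lra.
  have [|||s hs e] := @fiber_IVT_yl p (z / c) s2 z.
  - exact: s12.
  - by move=> s /andP[h3 _]; apply: ray_pos; exact: lt_le_trans h3.
  - by rewrite h1 h2.
  exists s => //; apply: ray_pos.
  by move/andP: hs => [h3 _]; exact: lt_le_trans h3.
have [y0|y0|y0] := ltgtP y 0; last 2 first.
- exact: pos.
- by exists y => //; rewrite y0 genY_fact mul0r.
have [|s hs e] := pos (- y); first by rewrite oppr_gt0.
exists (- s); last by rewrite genY_odd e opprK.
by have [h1 h2] := hs; split => //; rewrite sqrrN.
Qed.

(** Far to the left [lev >= 1] and [genX] is the identity. Far to the right the same holds if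
    [y^2 + q > 0], thanks to the weight [1 + x^6]. If [y = q = 0] the fibre ends at the tip, where
    [G] tends to infinity. *)
Lemma genX_surj p (x : R) : exists2 s, off_ray s (p 0 yl) (sqz p) &
  genX M k s (p 0 yl) (sqz p) = x.
Proof.
have q0 := sqz_ge0 p; have y0 := sqr_ge0 (p 0 yl).
set y := p 0 yl in y0 *; set q := sqz p in q0 *.
pose x1 := Num.min x (- 1).
have x1x : x1 <= x by rewrite ge_min lexx.
have x11 : x1 <= -1 by rewrite ge_min lexx orbT.
have r1 : off_ray x1 y q by split => //; right; lra.
have m1 s : 1 <= M * (1 + s ^+ 6).
  by rewrite -[leLHS]mul1r ler_pM //; have := x6_ge0 s; lra.
have h1 : genX M k x1 y q <= x.
  rewrite genX_level1 //.
  have [r0 _ _ hr] := off_rayP r1.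
  have x3 : x1 ^+ 3 <= -1.
    have -> : x1 ^+ 3 = - ((- x1) ^+ 3) by ring.
    by rewrite lerN2 exprn_ege1 //; lra.
  rewrite -[leLHS]mul1r ler_pM // /gap.
  by have := normr_ge0 (x1 ^+ 3); lra.
suff [x2 [x12 hr h2]] : exists x2, [/\ x1 <= x2,
    forall s, s <= x2 -> off_ray s y q & x <= genX M k x2 y q].
  have [|||s hs e] := @fiber_IVT_xl p x1 x2 x.
  - exact: x12.
  - by move=> s /andP[_ h3]; exact: hr.
  - by rewrite h1 h2.
  by exists s => //; apply: hr; case/andP: hs.
have [Q0|Q0] := ltP 0 (y ^+ 2 + q).
  have hr s : off_ray s y q by split => //; left.
  pose Q := y ^+ 2 + q.
  (* The constant gives [x2^3 Q >= 3], whence [(1 + x2^6) Q >= Q + 3 x2^3], which exceeds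
     [rho + x2^3] because [rho <= x2^3 + Q + 1]. *)
  pose x2 := Num.max x (Num.max 1 (3 / Q)).
  have xx2 : x <= x2 by rewrite le_max lexx.
  have x21 : 1 <= x2 by rewrite !le_max lexx orbT.
  have x2Q : 3 / Q <= x2 by rewrite !le_max lexx !orbT.
  exists x2; split => //; first lra.
  rewrite genX_level1 // /lev.
  have [r0 s0 r2 rx] := off_rayP (hr x2).
  have x3 : 0 < x2 ^+ 3 by rewrite exprn_gt0 //; lra.
  have x3x : x2 <= x2 ^+ 3.
    by rewrite -[leLHS]expr1 ler_weXn2l.
  have rr : rho x2 y q <= x2 ^+ 3 + Q + 1.
    rewrite -(@ler_pXn2r _ 2) // ?nnegrE ?(ltW r0) //; last by rewrite -/Q in Q0 *; lra.
    rewrite r2 -addrA -/Q.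
    have -> : x2 ^+ 6 = (x2 ^+ 3) ^+ 2 by rewrite -exprM.
    have : 0 <= x2 ^+ 3 * Q by rewrite mulr_ge0 // ltW.
    have : 0 <= Q ^+ 2 by exact: sqr_ge0.
    rewrite -/Q in Q0 *.
    have -> : (x2 ^+ 3 + Q + 1) ^+ 2 = (x2 ^+ 3) ^+ 2 + Q ^+ 2 + 1 + 2 * (x2 ^+ 3 * Q)
       + 2 * x2 ^+ 3 + 2 * Q by ring.
    lra.
  have gE : gap x2 y q = Q / (rho x2 y q + x2 ^+ 3).
    by rewrite /Q (rho_gap (hr x2)) mulfK // gt_eqF // addr_gt0.
  rewrite gE mulrA ler_pdivlMr ?addr_gt0 // mul1r.
  apply: (@le_trans _ _ ((1 + x2 ^+ 6) * Q)); last first.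
    rewrite ler_wpM2r ?(ltW Q0) // -[leLHS]mul1r ler_wpM2r // ltW //.
    exact: x6_gt0.
  have xQ3 : 3 <= x2 ^+ 3 * Q.
    by rewrite -ler_pdivrMr // (le_trans x2Q).
  have : 3 * x2 ^+ 3 <= x2 ^+ 6 * Q.
    have -> : x2 ^+ 6 * Q = x2 ^+ 3 * Q * x2 ^+ 3 by ring.
    by rewrite ler_wpM2r // ltW.
  rewrite mulrDl mul1r; lra.
have yE : y ^+ 2 = 0 by lra.
have qE : q = 0 by lra.
have hr s : s < 0 -> off_ray s y q by move=> s0; split => //; right.
have [c hc] := @G_lb R.
(* For [-1 <= x2 < 0] on the axis, [lev = 2 M (1 + x2^6) |x2|^3 <= 4 M |x2|]. Thus [|x2| <= e]
   yields [k G >= x + 1], and the extra 1 compensates [x2 >= -1]. *)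
pose e := expR (c - (x + 1) / k) / (4 * M).
have M4 : 0 < 4 * M by rewrite mulr_gt0.
have e0 : 0 < e by rewrite divr_gt0 // expR_gt0.
pose x2 := - Num.min 1 e.
have m0 : 0 < Num.min 1 e by rewrite lt_min ltr01.
have x20 : x2 < 0 by rewrite oppr_lt0.
have x21 : -1 <= x2 by rewrite lerN2 ge_min lexx.
have x2e : - x2 <= e by rewrite opprK ge_min lexx orbT.
exists x2; split; first lra.
  by move=> s sx2; apply: hr; exact: le_lt_trans x20.
have r2 := hr _ x20; have [r0 s0 rE _] := off_rayP r2.
have l0 := lev_gt0 M_gt0 r2.
rewrite /genX yE mulr0 mul0r subr0.
have rho_x : rho x2 y q = - x2 ^+ 3.
  rewrite /rho yE qE !addr0 -[6%N]/(3 * 2)%N exprM sqrtr_sqr ltr0_norm //.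
  by rewrite exprn_odd_lt0.
have lev_le : lev M x2 y q <= expR (c - (x + 1) / k).
  rewrite /lev /gap rho_x.
  have a1 : 0 < - x2 by rewrite oppr_gt0.
  have -> : - x2 ^+ 3 - x2 ^+ 3 = 2 * (- x2) ^+ 3 by ring.
  have a3 : (- x2) ^+ 3 <= - x2.
    by rewrite -[leRHS]expr1 ler_wiXn2l // ?(ltW a1) //; lra.
  have a6 : x2 ^+ 6 <= 1.
    have -> : x2 ^+ 6 = (- x2) ^+ 6 by ring.
    by rewrite exprn_ile1 ?(ltW a1) //; lra.
  apply: (@le_trans _ _ (M * 2 * (2 * e))).
    apply: ler_pM; rewrite ?mulr_ge0 ?(ltW M_gt0) ?exprn_ge0 ?(ltW a1) ?(ltW (x6_gt0 _)) //.
      by rewrite ler_wpM2l ?(ltW M_gt0) //; lra.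
    by rewrite ler_wpM2l // (le_trans a3).
  have -> : M * 2 * (2 * e) = e * (4 * M) by ring.
  by rewrite divfK // gt_eqF.
have ln_le : ln (lev M x2 y q) <= c - (x + 1) / k.
  by rewrite -[leRHS]expRK ler_ln // posrE // expR_gt0.
have hG := hc _ l0.
have : (x + 1) / k <= G (lev M x2 y q) by lra.
by rewrite ler_pdivrMr // mulrC; lra.
Qed.

End FiberBijections.

(** * The symplectomorphism *)

Lemma has_derivs_diff (R : realType) (d e : nat) (F : 'rV[R]_d -> 'rV[R]_e) p
    (dF : 'I_e -> 'rV[R]_d -> R) :
  (forall j, has_derivs (fun q => F q 0 j) p (dF j)) ->
  differentiable F p /\ forall v j, ('d F p v) 0 j = dF j v.
Proof.
move=> h; have dFp : differentiable F p by apply: diff_row_mx => j; case: (h j).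
split => // v j; rewrite -(deriveE _ dFp) derive_row_mx //.
by have [_ ->] := h j.
Qed.

Lemma derive_near_id (R : realType) (d : nat) (F : 'rV[R]_d -> 'rV[R]_d) q v :
  (\forall a \near q, F a = a) -> 'D_v F q = v.
Proof. by move=> h; rewrite (near_eq_derive v h); exact: derive_id. Qed.

Section Symplectomorphism.
Context {R : realType} {n : nat}.
Notation V := 'rV[R]_(2 * n.+1).
Implicit Types (p q u v w : V).
Local Notation xl := (@xl n).
Local Notation yl := (@yl n).
Local Notation M1 := (M1 R n).

Variables (M k : R).
Hypothesis (M1_le : 1 <= M) (k_gt0 : 0 < k).
Hypothesis hk : admissible M k.

Local Notation FY := (coordY (n := n) M k).
Local Notation FX := (coordX (n := n) M k).
Local Notation FA := (coordA (n := n) M k).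

(** Both maps are parametrised by [(z, x, Y)]: [mapA] gives the source point and [mapB] its image,
    so the symplectomorphism is [mapB] after the inverse of [mapA]. *)
Definition mapA p : V := upd p yl (FY p).
Definition mapB p : V := zrot (FA p) (upd p xl (FX p)).

Let M_gt0 : 0 < M. Proof. exact: lt_le_trans M1_le. Qed.
Let M_neq0 : M != 0. Proof. by rewrite gt_eqF. Qed.
Let oM1 := @open_M1 R n.

Lemma M1_zrot t p : M1 p -> M1 (zrot t p).
Proof. by rewrite !M1E /ray_coords zrot_xl zrot_yl sqz_zrot. Qed.

Lemma coordX_zrot t p : FX (zrot t p) = FX p.
Proof. by rewrite /coordX zrot_xl zrot_yl sqz_zrot. Qed.

Lemma coordA_zrot t p : FA (zrot t p) = FA p.
Proof. by rewrite /coordA zrot_xl zrot_yl sqz_zrot. Qed.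

Lemma M1_mapA p : M1 p -> M1 (mapA p).
Proof.
move=> hp; have /M1E rp := hp; apply/M1_upd_yl.
have [q0 h] := rp; split => //; case: h => [h|]; last by right.
left; have [q00|qp] := eqVneq (sqz p) 0; last first.
  have q1 : 0 < sqz p by rewrite lt_def qp.
  by have := sqr_ge0 (FY p); lra.
move: h; rewrite q00 !addr0 !exprn_even_gt0 //= => y0.
by rewrite -sgr_eq0 (genY_sg hk rp) sgr_eq0.
Qed.

Local Notation dFY p v :=
  (dgenY M k (p 0 xl) (p 0 yl) (sqz p) (v 0 xl) (v 0 yl) (dsqz p v)).
Local Notation dFX p v :=
  (dgenX M k (p 0 xl) (p 0 yl) (sqz p) (v 0 xl) (v 0 yl) (dsqz p v)).
Local Notation dFA p v :=
  (dgenA M k (p 0 xl) (p 0 yl) (sqz p) (v 0 xl) (v 0 yl) (dsqz p v)).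
Local Notation dBx p i v := (if i == ord_max then dFX p v
  else cos (FA p) * v 0 (xidx i) - sin (FA p) * v 0 (yidx i)
    - dFA p v * (sin (FA p) * p 0 (xidx i) + cos (FA p) * p 0 (yidx i))).
Local Notation dBy p i v := (if i == ord_max then v 0 yl
  else cos (FA p) * v 0 (yidx i) + sin (FA p) * v 0 (xidx i)
    + dFA p v * (cos (FA p) * p 0 (xidx i) - sin (FA p) * p 0 (yidx i))).

Lemma has_derivs_mapA_x p i : M1 p ->
  has_derivs (fun a => mapA a 0 (xidx i)) p (fun v => v 0 (xidx i)).
Proof.
move=> hp; rewrite /mapA; under [X in has_derivs X]eq_fun do rewrite mxE xidx_neq_yl.
exact: has_derivs_coord.
Qed.

Lemma has_derivs_mapA_y p i : M1 p ->
  has_derivs (fun a => mapA a 0 (yidx i)) p (fun v =>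
    if i == ord_max then dFY p v else v 0 (yidx i)).
Proof.
move=> hp; rewrite /mapA; under [X in has_derivs X]eq_fun do rewrite mxE yidx_eq_yl.
case: eqP => _; last exact: has_derivs_coord.
exact: has_derivs_coordY.
Qed.

Lemma has_derivs_mapB_x p i : M1 p ->
  has_derivs (fun a => mapB a 0 (xidx i)) p (fun v => dBx p i v).
Proof.
move=> hp; rewrite /mapB.
under [X in has_derivs X]eq_fun do rewrite zrot_x !mxE xidx_eq_xl yidx_neq_xl.
case: eqP => _; first exact: has_derivs_coordX.
have hc := has_derivs_comp (has_derivs_coordA k M1_le hp) (is_derive_cos (FA p)).
have hs := has_derivs_comp (has_derivs_coordA k M1_le hp) (is_derive_sin (FA p)).
apply: has_derivs_eq (has_derivsB (has_derivsM hc (has_derivs_coord _ p))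
  (has_derivsM hs (has_derivs_coord _ p))) _ => v /=.
ring.
Qed.

Lemma has_derivs_mapB_y p i : M1 p ->
  has_derivs (fun a => mapB a 0 (yidx i)) p (fun v => dBy p i v).
Proof.
move=> hp; rewrite /mapB.
under [X in has_derivs X]eq_fun do rewrite zrot_y !mxE xidx_eq_xl yidx_neq_xl.
have [->|ni] := eqVneq i ord_max; first exact: has_derivs_coord.
have hc := has_derivs_comp (has_derivs_coordA k M1_le hp) (is_derive_cos (FA p)).
have hs := has_derivs_comp (has_derivs_coordA k M1_le hp) (is_derive_sin (FA p)).
apply: has_derivs_eq (has_derivsD (has_derivsM hc (has_derivs_coord _ p))
  (has_derivsM hs (has_derivs_coord _ p))) _ => v /=.
ring.
Qed.

Lemma diff_pairs (F : V -> V) p (dFx dFy : 'I_n.+1 -> V -> R) :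
  (forall i, has_derivs (fun q => F q 0 (xidx i)) p (dFx i)) ->
  (forall i, has_derivs (fun q => F q 0 (yidx i)) p (dFy i)) ->
  [/\ differentiable F p, forall v i, ('d F p v) 0 (xidx i) = dFx i v
    & forall v i, ('d F p v) 0 (yidx i) = dFy i v].
Proof.
move=> hx hy.
have [|h1 h2] := @has_derivs_diff R _ _ F p
    (fun j => if odd j then dFy (pidx j) else dFx (pidx j)).
  by move=> j; rewrite [in X in has_derivs X](idx_cases j); case: ifP.
split => // v i; rewrite h2.
  by rewrite odd_xidx pidx_xidx.
by rewrite odd_yidx pidx_yidx.
Qed.

(** On the [z]-planes a rotation by the variable angle [FA] preserves the form up to
    [- (d FA /\ d q) / 2], and [gen_closed] says that the last plane compensates exactly this. The
    vectors enter through their coordinates only, which leaves pure algebra. *)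
Lemma omega0_mapA_mapB p p1 p2 u v (au av bu bv : V) : M1 p ->
  (forall i, au 0 (xidx i) = u 0 (xidx i)) ->
  (forall i, av 0 (xidx i) = v 0 (xidx i)) ->
  (forall i, au 0 (yidx i) = if i == ord_max then dFY p u else u 0 (yidx i)) ->
  (forall i, av 0 (yidx i) = if i == ord_max then dFY p v else v 0 (yidx i)) ->
  (forall i, bu 0 (xidx i) = dBx p i u) -> (forall i, bv 0 (xidx i) = dBx p i v) ->
  (forall i, bu 0 (yidx i) = dBy p i u) -> (forall i, bv 0 (yidx i) = dBy p i v) ->
  omega0 R n.+1 p1 bu bv = omega0 R n.+1 p2 au av.
Proof.
move=> hp Axu Axv Ayu Ayv Bxu Bxv Byu Byv.
rewrite /omega0 /wedge /dx /dy (bigD1 ord_max) //= [RHS](bigD1 ord_max) //=.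
rewrite Axu Axv Ayu Ayv Bxu Bxv Byu Byv eqxx.
have -> : \sum_(i < n.+1 | i != ord_max)
   (bu 0 (xidx i) * bv 0 (yidx i) - bv 0 (xidx i) * bu 0 (yidx i)) =
  \sum_(i < n.+1 | i != ord_max)
     (u 0 (xidx i) * v 0 (yidx i) - v 0 (xidx i) * u 0 (yidx i))
  - (dFA p u * dsqz p v - dFA p v * dsqz p u) / 2.
  rewrite /dsqz !mulr_sumr -sumrB mulr_suml -sumrB; apply: eq_bigr => i ni.
  rewrite Bxu Bxv Byu Byv (negbTE ni).
  move: (dFA p u) (dFA p v) => a b.
  have e := cos2Dsin2 (FA p).
  move: (cos (FA p)) (sin (FA p)) e => c s e.
  move: (u 0 (xidx i)) (u 0 (yidx i)) (v 0 (xidx i)) (v 0 (yidx i)) => ux uy vx vy.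
  move: (p 0 (xidx i)) (p 0 (yidx i)) => px py.
  transitivity ((c ^+ 2 + s ^+ 2) * (ux * vy - vx * uy -
     (a * (px * vx + py * vy) - b * (px * ux + py * uy)))); first by ring.
  by rewrite e; field.
have -> : \sum_(i < n.+1 | i != ord_max)
   (au 0 (xidx i) * av 0 (yidx i) - av 0 (xidx i) * au 0 (yidx i)) =
  \sum_(i < n.+1 | i != ord_max)
     (u 0 (xidx i) * v 0 (yidx i) - v 0 (xidx i) * u 0 (yidx i)).
  by apply: eq_bigr => i ni; rewrite Axu Axv Ayu Ayv (negbTE ni).
rewrite -/xl -/yl.
have /M1E rp := hp.
have := gen_closed k (u 0 xl) (v 0 xl) (u 0 yl) (v 0 yl) (dsqz p u) (dsqz p v) M_neq0 rp.
lra.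
Qed.

Lemma pullback_mapA_mapB p u v : M1 p ->
  [/\ differentiable mapA p, differentiable mapB p &
  omega0 R n.+1 (mapB p) ('d mapB p u) ('d mapB p v)
  = omega0 R n.+1 (mapA p) ('d mapA p u) ('d mapA p v)].
Proof.
move=> hp.
have [dA Ax Ay] := diff_pairs (fun i => has_derivs_mapA_x i hp) (fun i => has_derivs_mapA_y i hp).
have [dB Bx By] := diff_pairs (fun i => has_derivs_mapB_x i hp) (fun i => has_derivs_mapB_y i hp).
split; [exact: dA | exact: dB |].
exact: (omega0_mapA_mapB _ _ hp (Ax u) (Ax v) (Ay u) (Ay v) (Bx u) (Bx v) (By u) (By v)).
Qed.

Lemma exists_inverses : exists hA hB : V -> R,
  (forall q, M1 q -> M1 (upd q yl (hA q)) /\ FY (upd q yl (hA q)) = q 0 yl) /\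
  (forall q, M1 (upd q xl (hB q)) /\ FX (upd q xl (hB q)) = q 0 xl).
Proof.
have /choice[hA hA1] : forall q, exists s,
    M1 q -> M1 (upd q yl s) /\ FY (upd q yl s) = q 0 yl.
  (* The value 0 outside [M1] is a placeholder. *)
  move=> q; have [Mq|nM] := pselect (M1 q); last by exists 0.
  have /M1E rq := Mq; have [s h1 h2] := genY_surj M1_le hk rq.
  by exists s => _; split; [exact/M1_upd_yl | rewrite coordY_upd].
have /choice[hB hB1] : forall q, exists s,
    M1 (upd q xl s) /\ FX (upd q xl s) = q 0 xl.
  move=> q; have [s h1 h2] := genX_surj M1_le k_gt0 q (q 0 xl).
  by exists s; split; [exact/M1_upd_xl | rewrite coordX_upd].
by exists hA, hB.
Qed.

Lemma smooth_zrot (U : set V) (t : V -> R) (F : V -> V) j : open U ->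
  smooth U t -> (forall i, smooth U (fun p => F p 0 i)) ->
  smooth U (fun p => zrot (t p) (F p) 0 j).
Proof.
move=> oU st sF m; under [X in Cks _ _ X]eq_fun do rewrite !mxE.
have [sc ss] := Cks_trigo oU (st m).
case: eqP => _; first exact: sF.
apply: CksD => //; apply: CksM => //; first exact: sF.
by case: (odd j); [exact: sF | apply: CksN => //; exact: sF].
Qed.

Lemma symplectomorphism_off_ray : exists phi : V -> V,
  symplectomorphism M1 (omega0 R n.+1) [set: V] (omega0 R n.+1) phi /\
  forall p, M1 p -> 1 <= lev M (p 0 xl) (p 0 yl) (sqz p) -> phi p = p.
Proof.
have [hA [hB [hA1 hB1]]] := exists_inverses.
pose SA q := upd q yl (hA q); pose SB q := upd q xl (hB q).
have injA := @coordY_inj R n M k M1_le hk.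
have injB := @coordX_inj R n M k M1_le hk.
have A_SA q : M1 q -> mapA (SA q) = q.
  by move=> /hA1[_ h]; rewrite /mapA h upd_upd upd_id.
have SA_A p : M1 p -> SA (mapA p) = p.
  move=> hp; have hAp := M1_mapA hp; have [h1 h2] := hA1 _ hAp.
  by apply: injA => //; rewrite h2 /SA upd_upd upd_id.
have SB_B p : M1 p -> SB (mapB p) = zrot (FA p) p.
  move=> hp; have [h1 h2] := hB1 (mapB p).
  apply: injB => //; first exact: M1_zrot.
  by rewrite h2 /SB upd_upd upd_id coordX_zrot -zrot_upd_xl.
have sA : smooth M1 hA.
  apply: (@fiber_inverse_smooth R _ yl M1 M1 FY hA) => //.
  - exact: smooth_coordY.
  - by move=> p; exact: coordY_deriv_gt0.
  - by move=> q /hA1[].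
  - by move=> q /hA1[].
have sB : smooth setT hB.
  apply: (@fiber_inverse_smooth R _ xl M1 setT FX hB) => //.
  - exact: openT.
  - exact: smooth_coordX.
  - by move=> p; exact: coordX_deriv_gt0.
  - by move=> q _; case: (hB1 q).
  - by move=> q _; case: (hB1 q).
have sFA : smooth M1 FA by exact: smooth_coordA.
exists (mapB \o SA); split; last first.
  move=> p hp lp.
  have Ap : mapA p = p by rewrite /mapA /coordY genY_level1 // upd_id.
  (* At level at least 1 the point is fixed by [mapA], hence by its inverse [SA], and [mapB] has
     zero shift and zero angle there. *)
  rewrite /= -{1}Ap SA_A // /mapB /coordX /coordA genX_level1 // genA_level1 //.
  by rewrite upd_id zrot0.
split.
  (* [SB] undoes the shift in [x] but leaves [z] rotated. The angle depends on [z] only through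
     [|z|^2], so it can be read off the rotated point and undone. *)
  exists (fun q => mapA (zrot (- FA (SB q)) (SB q))); split.
  - move=> q Mq; split => //=; have [h1 _] := hA1 _ Mq.
    by rewrite SB_B // coordA_zrot zrotNK A_SA.
  - move=> q _; have [h1 h2] := hB1 q.
    have hr : M1 (zrot (- FA (SB q)) (SB q)) by exact: M1_zrot.
    split; first exact: M1_mapA.
    rewrite /= SA_A // /mapB coordA_zrot coordX_zrot zrot_upd_xl.
    by rewrite -{1}[FA (SB q)]opprK zrotNK h2 upd_upd upd_id.
  - apply: smooth_on_coord => // j m /=.
    apply: (Cks_comp (V := M1) (g := fun p => mapB p 0 j)) => //.
    + by move=> q /hA1[].
    + by move=> i; apply: Cks_upd => //; exact: sA.
    + apply: smooth_zrot => // i l; apply: Cks_upd => //; exact: smooth_coordX.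
  - apply: smooth_on_coord; first exact: openT.
    move=> j m.
    apply: (Cks_comp (V := M1) (F := SB)
      (g := fun p => mapA (zrot (- FA p) p) 0 j)) => //.
    + exact: openT.
    + by move=> q _; case: (hB1 q).
    + by move=> i; apply: Cks_upd; [exact: openT | exact: sB].
    apply: (Cks_comp (V := M1) (F := fun p => zrot (- FA p) p)
      (g := fun p => mapA p 0 j)) => //.
    + by move=> p; exact: M1_zrot.
    + move=> i; apply: smooth_zrot => // l; first exact: CksN.
      by move=> m'; exact: Cks_coord.
    + apply: Cks_upd => //; exact: smooth_coordY.
move=> q Mq u v; rewrite /pullback /=.
have [h1 _] := hA1 _ Mq.
have dSA : differentiable SA q.
  apply: diff_row_mx => j; have : Cks 1 M1 (fun p => SA p 0 j).
    by apply: Cks_upd => //; exact: sA.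
  by case=> h _; exact: h.
have [dA dB e] := pullback_mapA_mapB ('d SA q u) ('d SA q v) h1.
have dphi w : 'd (mapB \o SA) q w = 'd mapB (SA q) ('d SA q w).
  exact (congr1 (fun f : V -> V => f w) (diff_comp dSA dB)).
(* Differentiation of [mapA \o SA], which is the identity on the open set [M1]. The equality of the
   two pullbacks, applied to the vectors ['d SA q u] and ['d SA q v], then gives the claim. *)
have dASA w : 'd mapA (SA q) ('d SA q w) = w.
  apply: etrans (esym (congr1 (fun f : V -> V => f w) (diff_comp dSA dA))) _.
  have dd : differentiable (mapA \o SA) q by exact: differentiable_comp.
  rewrite -(deriveE _ dd).
  apply: derive_near_id.
  have nM : nbhs q M1 := open_nbhs_nbhs (conj oM1 Mq).
  exact: (filterS A_SA nM).
apply: etrans (congr2 (omega0 R n.+1 (mapB (SA q))) (dphi u) (dphi v)) _.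
apply: etrans e _.
exact (congr2 (omega0 R n.+1 (mapA (SA q))) (dASA u) (dASA v)).
Qed.

End Symplectomorphism.

(** * Support *)

Section Support.
Context {R : realType}.
Implicit Types (x y q M eps : R).

Lemma pow_le_1Dx6 x m : (m <= 6)%N -> x ^+ m <= 1 + x ^+ 6.
Proof.
move=> m6; apply: (le_trans (ler_norm _)); rewrite normrX.
rewrite -[x ^+ 6]ger0_norm ?x6_ge0 // normrX.
have := normr_ge0 x; move: `|x| => a a0; case: (leP a 1) => a1.
  have : a ^+ m <= 1 by rewrite exprn_ile1.
  by have := x6_ge0 a; lra.
have : a ^+ m <= a ^+ 6 by rewrite ler_weXn2l // ltW.
lra.
Qed.

(** With [g = gap], [y^2 + q = g (g + 2 x^3)], and [lev < 1] bounds every [M g x^m] with [m <= 6] by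
    1. The exponents 3 and 5 occur, and each 3 is [1 + 2]. For [x < 0], [g >= 2 |x|^3] gives the
    last bound. *)
Lemma lev_lt1_bounds M x y q : 1 <= M -> off_ray x y q -> lev M x y q < 1 ->
  [/\ M * (y ^+ 2 + q) <= 3, M * (x ^+ 2 * (y ^+ 2 + q)) <= 3
    & x < 0 -> 2 * (M * (- x) ^+ 3) <= 1].
Proof.
move=> M1 h; have [r0 g0 r2 rx] := off_rayP h; have eQ := rho_gap h.
set g := gap x y q in g0 eQ; rewrite /lev -/g => l1.
have M0 : 0 < M by lra.
have rE : rho x y q = g + x ^+ 3 by rewrite /g /gap subrK.
have Mg0 : 0 <= M * g by rewrite mulr_ge0 // ltW.
have Mg1 : M * g <= 1.
  have : 0 <= M * g * x ^+ 6 by exact: mulr_ge0 Mg0 (x6_ge0 x).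
  have : M * (1 + x ^+ 6) * g = M * g + M * g * x ^+ 6 by ring.
  lra.
have g1 : g <= 1.
  have : 0 <= (M - 1) * g by apply: mulr_ge0 (ltW g0); lra.
  rewrite mulrBl; lra.
have pw m : (m <= 6)%N -> M * g * x ^+ m <= 1.
  move=> m6; apply: (@le_trans _ _ (M * g * (1 + x ^+ 6))).
    by rewrite ler_wpM2l // pow_le_1Dx6.
  by rewrite mulrAC ltW.
have Mgx2 : 0 <= M * g * x ^+ 2 by rewrite mulr_ge0 // sqr_ge0.
split.
- have -> : M * (y ^+ 2 + q) = M * g * g + 2 * (M * g * x ^+ 3).
    by rewrite eQ rE; ring.
  have : M * g * g <= 1 * 1 by rewrite ler_pM // ltW.
  have := pw 3 isT; lra.
- have -> : M * (x ^+ 2 * (y ^+ 2 + q)) = M * g * x ^+ 2 * g + 2 * (M * g * x ^+ 5).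
    by rewrite eQ rE; ring.
  have : M * g * x ^+ 2 * g <= 1 * 1 by apply: ler_pM; rewrite ?(ltW g0) ?pw.
  have := pw 5 isT; lra.
move=> x0; have h3 : - x ^+ 3 <= rho x y q by have := lerNnormlW rx; lra.
have : M * (- x ^+ 3 * 2) <= M * g by rewrite ler_pM2l // /g /gap; lra.
have -> : (- x) ^+ 3 = - x ^+ 3 by ring.
lra.
Qed.

Lemma sum_pairs n (f : 'I_(2 * n) -> R) :
  \sum_(j < 2 * n) f j = \sum_(i < n) (f (xidx i) + f (yidx i)).
Proof.
(* Extension by 0 to all naturals, so that the induction on [n] is free of bounded indices. *)
pose g m := if insub m is Some j then f j else 0.
have gE j : g (nat_of_ord j) = f j by rewrite /g valK.
transitivity (\sum_(0 <= m < 2 * n) g m).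
  by rewrite big_mkord; apply: eq_bigr => j _; rewrite gE.
have -> : \sum_(0 <= m < 2 * n) g m = \sum_(0 <= m < n) (g (2 * m)%N + g (2 * m).+1).
  move: g {gE} => g; elim: n {f} => [|n IH]; first by rewrite muln0 !big_geq.
  by rewrite mulnS addnC addn2 !big_nat_recr //= IH addrA.
rewrite big_mkord; apply: eq_bigr => i _.
by rewrite -(gE (xidx i)) -(gE (yidx i)).
Qed.

Lemma split_last_sqz n (p : 'rV[R]_(2 * n.+1)) :
  \sum_(j < 2 * n) (split_last p).1 0 j ^+ 2 = sqz p.
Proof.
rewrite sum_pairs /sqz [RHS]big_mkcond big_ord_recr /= eqxx addr0.
apply: eq_bigr => i _; rewrite ifT; last first.
  by apply/eqP => /(congr1 val) /=; have := ltn_ord i; lia.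
by rewrite !mxE !castmxE /=; congr (p _ _ ^+ 2 + p _ _ ^+ 2); apply: val_inj.
Qed.

Lemma split_last_x n (p : 'rV[R]_(2 * n.+1)) : (split_last p).2 0 0 = p 0 (xl (n := n)).
Proof.
by rewrite mxE castmxE /=; congr (p _ _); apply: val_inj => //=; rewrite addn0.
Qed.

Lemma split_last_y n (p : 'rV[R]_(2 * n.+1)) : (split_last p).2 0 1 = p 0 (yl (n := n)).
Proof.
by rewrite mxE castmxE /=; congr (p _ _); apply: val_inj => //=; rewrite addn1.
Qed.

Lemma enorm_lt d (v : 'rV[R]_d) eps : 0 < eps ->
  \sum_(j < d) v 0 j ^+ 2 < eps ^+ 2 -> eball 0 eps v.
Proof.
move=> e0 h; rewrite /eball /= /enorm subr0.
by rewrite -[X in _ < X](gtr0_norm e0) -sqrtr_sqr ltr_sqrt // exprn_gt0.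
Qed.

(** Together with [lev_lt1_bounds] the three constants give [y^2 + q < eps^2 / 2],
    [x^2 y^2 < eps^4 / 4] and, for [x < 0], [|x| < eps / 2]. *)
Lemma exists_level eps : 0 < eps -> exists M, [/\ 1 <= M,
  6 < M * eps ^+ 2, 12 < M * eps ^+ 4 & 4 < M * eps ^+ 3].
Proof.
move=> e0.
have p m : 0 < eps ^+ m by rewrite exprn_gt0.
exists (1 + (6 / eps ^+ 2 + 12 / eps ^+ 4 + 4 / eps ^+ 3)).
have a2 : 0 < 6 / eps ^+ 2 by rewrite divr_gt0.
have a4 : 0 < 12 / eps ^+ 4 by rewrite divr_gt0.
have a3 : 0 < 4 / eps ^+ 3 by rewrite divr_gt0.
by split; [|rewrite -ltr_pdivrMr //..]; lra.
Qed.

Lemma lev_ge1_off_support n M eps (p : 'rV[R]_(2 * n.+1)) : 0 < eps -> 1 <= M ->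
  6 < M * eps ^+ 2 -> 12 < M * eps ^+ 4 -> 4 < M * eps ^+ 3 -> M1 R n p ->
  ~ prod_last (eball (0 : 'rV[R]_(2 * n)) eps) (W eps) p ->
  1 <= lev M (p 0 xl) (p 0 yl) (sqz p).
Proof.
move=> e0 M1 h2 h4 h3 /M1E hp hout; rewrite leNgt; apply/negP => l1; apply: hout.
have [b1 b2 b3] := lev_lt1_bounds M1 hp l1.
have q0 := sqz_ge0 p; have y20 := sqr_ge0 (p 0 yl).
have M0 : 0 < M by lra.
have e20 : 0 < eps ^+ 2 by rewrite exprn_gt0.
move: (sqz p) (split_last_sqz p) q0 b1 b2 => q qE q0 b1 b2.
have Qe : 2 * (p 0 yl ^+ 2 + q) < eps ^+ 2.
  by rewrite -(ltr_pM2l M0); lra.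
split; first by apply: enorm_lt => //; rewrite qE; lra.
have xE := split_last_x p; have yE := split_last_y p.
move: (p 0 xl) (p 0 yl) xE yE b1 b2 b3 Qe y20 => x y xE yE b1 b2 b3 Qe y20.
have s2 : Num.sqrt 2 ^+ 2 = 2 :> R by rewrite sqr_sqrtr.
have s20 : 0 < Num.sqrt 2 :> R by rewrite sqrtr_gt0.
have c2 : (Num.sqrt 2 * eps / 2) ^+ 2 = eps ^+ 2 / 2.
  by rewrite !exprMn s2 exprVn; field.
have c0 : 0 < Num.sqrt 2 * eps / 2 by rewrite divr_gt0 // mulr_gt0.
(* The threshold squares to [eps^2 / 2]: beyond it the hyperbolic part of [W] applies, and up to it
   [x^2] and [y^2] share [eps^2] evenly, which gives the ball. *)
have [xs|xs] := ltP (Num.sqrt 2 * eps / 2) x.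
  right; split; rewrite xE // yE.
  have x0 : 0 < x by lra.
  rewrite -(@ltr_pXn2r _ 2) // ?nnegrE; last 2 first.
  - by rewrite mulr_ge0 // ltW.
  - by rewrite divr_ge0 // ltW.
  rewrite exprMn real_normK ?num_real //.
  have -> : (eps ^+ 2 / 2) ^+ 2 = eps ^+ 4 / 4 by field.
  rewrite -(ltr_pM2l M0).
  have : 0 <= M * (x ^+ 2 * q) by rewrite !mulr_ge0 // ?sqr_ge0 // ltW.
  move: b2; rewrite !mulrDr; lra.
left; apply: enorm_lt => //.
rewrite big_ord_recl big_ord1 xE.
have -> : lift ord0 ord0 = 1 :> 'I_2 by apply: val_inj.
rewrite yE.
suff : x ^+ 2 <= eps ^+ 2 / 2 by lra.
have [x0|x0] := leP 0 x.
  by rewrite -c2 lerXn2r // nnegrE // ltW.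
have x1 : - x < eps / 2.
  rewrite -(@ltr_pXn2r _ 3) // ?nnegrE; [|by lra..].
  rewrite -(ltr_pM2l M0).
  have -> : (eps / 2) ^+ 3 = eps ^+ 3 / 8 by field.
  by have := b3 x0; lra.
have : (- x) ^+ 2 < (eps / 2) ^+ 2.
  by rewrite ltr_pXn2r // nnegrE; lra.
rewrite sqrrN expr_div_n; lra.
Qed.

End Support.

Theorem theorem1p1 (R : realType) (n : nat) :
  symplectomorphic (M1 R n) (omega0 R n.+1) [set: 'rV[R]_(2 * n.+1)] (omega0 R n.+1)
  /\
  forall eps : R, 0 < eps ->
    exists phi : 'rV[R]_(2 * n.+1) -> 'rV[R]_(2 * n.+1),
      symplectomorphism (M1 R n) (omega0 R n.+1)
        [set: 'rV[R]_(2 * n.+1)] (omega0 R n.+1) phi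
      /\ forall p, M1 R n p -> ~ prod_last (eball (0 : 'rV[R]_(2 * n)) eps) (W eps) p ->
           phi p = p.
Proof.
suff main : forall eps : R, 0 < eps ->
    exists phi : 'rV[R]_(2 * n.+1) -> 'rV[R]_(2 * n.+1),
      symplectomorphism (M1 R n) (omega0 R n.+1)
        [set: 'rV[R]_(2 * n.+1)] (omega0 R n.+1) phi
      /\ forall p, M1 R n p -> ~ prod_last (eball (0 : 'rV[R]_(2 * n)) eps) (W eps) p ->
           phi p = p.
  by split => //; have [phi [h _]] := main 1 ltr01; exists phi.
move=> eps e0; have [M [M1 h2 h4 h3]] := exists_level e0.
have [k k0 hk] := @exists_admissible R M (lt_le_trans ltr01 M1).
have [phi [sphi idphi]] := symplectomorphism_off_ray (n := n) M1 k0 hk.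
exists phi; split => // p hp hout.
by apply: idphi => //; exact: (lev_ge1_off_support (eps := eps)).
Qed.
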